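(* Let $Y$ be a general diffusion in natural scale with state space $I$, interior $I^\circ=(l,r)$, speed measure $m$ and absorbing accessible boundary points, and let $(a_h)_{h\in(0,\bar h)}$ be a family of scale factors with associated processes $X^{h,y}=(X^{h,y}_t)_{t\in[0,\infty)}$ (all as specified in the context). Assume that for every compact subset $K$ of $I^\circ$ $$\sup_{y\in K}\left|\frac12\int_{(y-a_h(y),y+a_h(y))}\bigl(a_h(y)-|u-y|\bigr)\,m(du)-h\right|\in o(h),\qquad h\to0.$$ Then for every $y\in I^\circ$ the distributions of the processes $(X^{h,y}_t)_{t\in[0,\infty)}$ under $P$ converge weakly to the distribution of $(Y_t)_{t\in[0,\infty)}$ under $P_y$ as $h\to0$; that is, for every bounded and continuous functional $F\colon C([0,\infty),\mathbb R)\to\mathbb R$ it holds that $$E[F(X^{h,y})]\to E_y[F(Y)],\qquad h\to0.$$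
   Context: General diffusion: $I\subseteq\mathbb R$ is an open, half-open or closed interval with interior $I^\circ=(l,r)$, $-\infty\le l<r\le\infty$, and $\bar I=[l,r]$. $(\Omega,\mathcal F,(\mathcal F_t)_{t\ge0},(P_y)_{y\in I},(Y_t)_{t\ge0})$ is a one-dimensional continuous strong Markov process with state space $I$ and $P_y[Y_0=y]=1$ for $y\in I$ (in the sense of Revuz–Yor, Section VII.3). For $x\in\bar I$ let $H_x=\inf\{t\ge0:Y_t=x\}$ and $H_{a,b}=H_a\wedge H_b$. $Y$ is regular: $P_y[H_x<\infty]>0$ for all $y\in I^\circ$, $x\in I$. $Y$ is in natural scale: $P_y[H_b<H_a]=\frac{y-a}{b-a}$ for $a<y<b$, $a,b\in I$. A boundary point is accessible if and only if it belongs to $I$, and every accessible boundary point is absorbing. The speed measure $m$ satisfies $0<m([a,b])<\infty$ for all $a<b$ in $I^\circ$ and is normalized so that $E_y[H_{a,b}]=\int_{(a,b)}\frac{(b-y\vee u)(y\wedge u-a)}{b-a}\,m(du)$ for all $a<b$ in $I$ and $y\in[a,b]$ (so Brownian motion has speed measure $2\,dx$). Scale factors: $\bar h\in(0,\infty)$ and for every $h\in(0,\bar h)$, $a_h\colon\bar I\to[0,\infty)$ is a measurable function with $a_h(l)=a_h(r)=0$ and $y\pm a_h(y)\in I$ for all $y\in I^\circ$. Associated processes: let $(\xi_k)_{k\in\mathbb N}$ be iid on a probability space with measure $P$ (expectation $E$), $P(\xi_k=\pm1)=\frac12$. For $y\in I^\circ$, $h\in(0,\bar h)$ set $X^{h,y}_0=y$,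 $X^{h,y}_{(k+1)h}=X^{h,y}_{kh}+a_h(X^{h,y}_{kh})\xi_{k+1}$ for $k\in\mathbb N_0$, and extend by linear interpolation: $X^{h,y}_t=X^{h,y}_{\lfloor t/h\rfloor h}+(t/h-\lfloor t/h\rfloor)\bigl(X^{h,y}_{(\lfloor t/h\rfloor+1)h}-X^{h,y}_{\lfloor t/h\rfloor h}\bigr)$, $t\in[0,\infty)$. $C([0,\infty),\mathbb R)$ is equipped with the topology of uniform convergence on compact intervals. *)

(* Defs.v *)
From HB Require Import structures.
From mathcomp Require Import all_boot all_order all_algebra.
From mathcomp Require Import finmap ring.
From mathcomp Require Import all_classical all_reals all_analysis.
From mathcomp Require Import measurable_realfun.

Set Implicit Arguments.
Unset Strict Implicit.
Unset Printing Implicit Defensive.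

Import Order.TTheory GRing.Theory Num.Theory.
Import numFieldNormedType.Exports.

Local Open Scope classical_set_scope.
Local Open Scope ring_scope.

(* The half-line [0, oo), as a topological subspace of R. *)
Definition time (R : realType) : Type := set_type [set t : R | 0 <= t].
HB.instance Definition _ (R : realType) := Uniform.on (time R).

Lemma time0_subproof (R : realType) : (0 : R) \in [set t : R | 0 <= t].
Proof. by rewrite inE /=. Qed.

Definition time0 (R : realType) : time R := exist _ 0 (time0_subproof R).

(* [to_time t] is the real t seen as a time; negative reals, for which it is
   never used, are sent to 0. *)
Definition to_time (R : realType) (t : R) : time R := insubd (time0 R) t.

(* C([0, oo), R), with the topology of uniform convergence on the compact
   intervals [a, b] of [0, oo). *)
Definition time_segments (R : realType) : set (set (time R)) :=
  [set K | exists a b : R, K = [set t | a <= \val t <= b]].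

Definition cpath (R : realType) : Type := continuousType (time R) R.
HB.instance Definition _ (R : realType) := Topological.copy (cpath R)
  (initial_topology
     (fun f : cpath R => (f : {family @time_segments R, time R -> R}))).

Section linear_interpolation.
Context {R : realType}.
Implicit Types (x : nat -> R) (s : R).

Definition interpolate x s : R :=
  x (Num.truncn s) + (s - (Num.truncn s)%:R)
                     * (x (Num.truncn s).+1 - x (Num.truncn s)).

Let pl x := fix pl (n : nat) (s : R) : R :=
  if n is n'.+1
  then pl n' s + Num.max (s - n%:R) 0 * (x n.+1 - x n - (x n - x n'))
  else x 0%N + s * (x 1%N - x 0%N).

Let pl_cts x n : continuous (pl x n).
Proof.
elim: n => [|n ih] s /=.
  by apply: cvgD; [exact: cvg_cst|apply: cvgMr_tmp; exact: cvg_id].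
apply: cvgD; first exact: ih.
apply: cvgMr_tmp; apply: (@continuous_max _ _ _ _ s); last exact: cvg_cst.
by apply: cvgB; [exact: cvg_id|exact: cvg_cst].
Qed.

Let pl_ge x n s : n%:R <= s -> pl x n s = x n + (s - n%:R) * (x n.+1 - x n).
Proof.
elim: n => [|n ih] /= ns; first by rewrite subr0.
have ns' : n%:R <= s by rewrite (le_trans _ ns)// ler_nat.
rewrite ih// max_l ?subr_ge0// -natr1; ring.
Qed.

Let pl_lt x n s : s < n.+1%:R -> interpolate x s = pl x n s.
Proof.
elim: n => [|n ih] sn.
  have s0 : Num.truncn s = 0%N by apply/truncn0Pn; rewrite -ltNge.
  by rewrite /interpolate s0 subr0.
have [sn'|ns] := ltP s n.+1%:R.
  by rewrite /= max_r ?subr_le0 1?ltW// mul0r addr0 ih.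
have truncE : Num.truncn s = n.+1 by apply/truncn_def/andP.
by rewrite pl_ge// /interpolate truncE.
Qed.

Lemma interpolate_continuous x : continuous (interpolate x).
Proof.
move=> s; pose n := Num.truncn s.
have sn : s < n.+1%:R by apply: real_truncnS_gt; exact: num_real.
rewrite /continuous_at (pl_lt x sn).
apply: cvg_trans (pl_cts (x := x) (n := n) (x0 := s)).
apply: near_eq_cvg; near=> t; apply/esym/pl_lt.
by near: t; exact: lt_nbhsl.
Unshelve. all: by end_near. Qed.

Lemma time_val_continuous : continuous (fun t : time R => \val t).
Proof. exact: (@initial_continuous (time R) R set_val). Qed.

Lemma interpolation_continuous (h : R) x :
  continuous (fun t : time R => interpolate x (\val t / h)).
Proof.
move=> t; apply: (@continuous_comp (time R) R R (fun t => \val t / h)).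
  by apply: (@cvgMr_tmp _ _ (nbhs t)); exact: (@time_val_continuous t).
exact: interpolate_continuous.
Qed.

(* [x k] is the value at time k * h. *)
Definition interpolation (h : R) x : cpath R :=
  mkcts (@interpolation_continuous h x).

End linear_interpolation.

(* With values in [0, +oo]: the infimum of the empty set is +oo. *)
Definition hitting_time (R : realType) (x : \bar R) (f : cpath R) : \bar R :=
  ereal_inf [set (\val t)%:E | t in [set t : time R | (f t)%:E = x]].

Definition hitting_time2 (R : realType) (a b : \bar R) (f : cpath R) : \bar R :=
  Order.min (hitting_time a f) (hitting_time b f).

(* The product sigma-algebra on the functions from [0, oo) to R. *)
Definition cylinder_algebra (R : realType) : set_system (time R -> R) :=
  <<s [set C | exists (t : time R) (B : set R),
        measurable B /\ C = [set f | B (f t)]] >>.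

Section markov.
Context {R : realType} {d : measure_display} {Omega : measurableType d}.
Implicit Types (Ft : time R -> set_system Omega) (tau : Omega -> \bar R)
  (Y : Omega -> cpath R).

Record filtration Ft : Prop := {
  filtration_sigma_algebra : forall t, sigma_algebra [set: Omega] (Ft t);
  filtration_measurable : forall t, Ft t `<=` measurable;
  filtration_nondecreasing : forall s t, \val s <= \val t -> Ft s `<=` Ft t }.

Definition adapted Ft Y : Prop :=
  forall (t : time R) (B : set R), measurable B -> Ft t [set w | B (Y w t)].

Definition stopping_time Ft tau : Prop :=
  (forall w, (0 <= tau w)%E) /\
  forall t : time R, Ft t [set w | (tau w <= (\val t)%:E)%E].

Definition stopped_algebra Ft tau : set_system Omega :=
  [set A | measurable A /\
     forall t : time R, Ft t (A `&` [set w | (tau w <= (\val t)%:E)%E])].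

(* The path of Y after time [tau w], when [tau w] is finite. *)
Definition shifted tau Y (w : Omega) : time R -> R :=
  fun s => Y w (to_time (fine (tau w) + \val s)).

(* As in Revuz-Yor, Section VII.3, without killing: the process never leaves I.
   The measures [P y] with y outside I play no role. In [csm_strong_markov],
   the identity for all A in F_tau and all B says that, on {tau < oo},
   P_{Y_tau}[Y in B] is a version of P_y[Y o theta_tau in B | F_tau]; by
   linearity and monotone class this is the strong Markov property for bounded
   functionals, and by integration in y it gives the property for all initial
   laws. *)
Record continuous_strong_markov (I : set R) (P : R -> probability Omega R)
    Ft Y : Prop := {
  csm_filtration : filtration Ft;
  csm_adapted : adapted Ft Y;
  csm_state_space : forall w t, I (Y w t);
  csm_start : forall y, I y -> P y [set w | Y w (time0 R) = y] = 1%E;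
  csm_kernel : forall B, cylinder_algebra B ->
    measurable_fun I (fun y => P y [set w | B (Y w)]);
  csm_strong_markov : forall (y : R) (tau : Omega -> \bar R)
      (A : set Omega) (B : set (time R -> R)),
    I y -> stopping_time Ft tau -> stopped_algebra Ft tau A ->
    cylinder_algebra B ->
    P y (A `&` [set w | (tau w < +oo)%E] `&` [set w | B (shifted tau Y w)]) =
    (\int[P y]_(w in A `&` [set w | (tau w < +oo)%E])
       P (Y w (to_time (fine (tau w)))) [set w' | B (Y w')])%E }.

Definition accessible (I : set R) (P : R -> probability Omega R) Y
    (z : \bar R) : Prop :=
  exists2 y, interior I y & (0 < P y [set w | hitting_time z (Y w) < +oo])%E.

(* l and r are the endpoints of I. The speed measure is a measure on (l, r); m
   is any extension of it to R, and only its restriction to (l, r) is used. *)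
Record general_diffusion (I : set R) (l r : \bar R)
    (P : R -> probability Omega R) Ft Y
    (m : {measure set (measurableTypeR R) -> \bar R}) : Prop := {
  gd_interval : is_interval I;
  gd_endpoints : (l < r)%E;
  gd_interior : interior I = [set x | (l < x%:E < r)%E];
  gd_process : continuous_strong_markov I P Ft Y;
  gd_regular : forall y x, interior I y -> I x ->
    (0 < P y [set w | hitting_time x%:E (Y w) < +oo])%E;
  gd_natural_scale : forall a b y, I a -> I b -> a < y < b ->
    P y [set w | (hitting_time b%:E (Y w) < hitting_time a%:E (Y w))%E] =
    ((y - a) / (b - a))%:E;
  gd_accessible : forall z, z = l \/ z = r ->
    (accessible I P Y z <-> exists2 x, I x & z = x%:E);
  gd_absorbing : forall x, I x -> x%:E = l \/ x%:E = r ->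
    P x [set w | forall t, Y w t = x] = 1%E;
  gd_speed_measure : forall a b, interior I a -> interior I b -> a < b ->
    (0 < m `[a, b]%classic < +oo)%E;
  gd_exit_time : forall a b y, I a -> I b -> a < b -> a <= y <= b ->
    (\int[P y]_w hitting_time2 a%:E b%:E (Y w))%E =
    (\int[m]_(u in `]a, b[)
       ((b - Num.max y u) * (Num.min y u - a) / (b - a))%:E)%E }.

End markov.

(* The domain of [a h] is [l, r], a subset of the extended real line. *)
Record scale_factors (R : realType) (I : set R) (l r : \bar R) (hbar : R)
    (a : R -> \bar R -> R) : Prop := {
  sf_measurable : forall h, 0 < h < hbar ->
    measurable_fun [set x | (l <= x <= r)%E] (a h);
  sf_ge0 : forall h x, 0 < h < hbar -> (l <= x <= r)%E -> 0 <= a h x;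
  sf_boundary : forall h, 0 < h < hbar -> a h l = 0 /\ a h r = 0;
  sf_state_space : forall h y, 0 < h < hbar -> interior I y ->
    I (y + a h y%:E) /\ I (y - a h y%:E) }.

Section random_walk.
Context {R : realType} {d : measure_display} {T : measurableType d}.

Record iid_signs (P : probability T R) (xi : nat -> {RV P >-> R}) : Prop := {
  signs_law : forall k, P [set w | xi k w = 1] = (2^-1)%:E /\
                        P [set w | xi k w = -1] = (2^-1)%:E;
  signs_independent : forall (J : {fset nat}) (B : nat -> set R),
    (forall k, measurable (B k)) ->
    P (\bigcap_(k in [set` J]) [set w | B k (xi k w)]) =
    (\prod_(k <- J) P [set w | B k (xi k w)])%E }.

(* [embedded_chain b y e k] is X_{kh} for b = a_h, with [e k] in the role of
   xi_{k+1}. *)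
Fixpoint embedded_chain (b : \bar R -> R) (y : R) (e : nat -> R) (k : nat) : R :=
  if k is k'.+1
  then embedded_chain b y e k' + b (embedded_chain b y e k')%:E * e k'
  else y.

Definition associated_process (a : R -> \bar R -> R) (xi : nat -> T -> R)
    (h y : R) (w : T) : cpath R :=
  interpolation h (embedded_chain (a h) y (xi^~ w)).

End random_walk.

(* f(h) = o(h) as h decreases to 0, for f with values in the extended reals:
   this also requires f(h) to be finite for small h. *)
Definition small_o_id (R : realType) (f : R -> \bar R) : Prop :=
  forall e : R, 0 < e -> \forall h \near 0^'+, (`|f h| <= (e * h)%:E)%E.

(* The supremum over K of |1/2 int_(y - a_h(y), y + a_h(y)) (a_h(y) - |u - y|)
   m(du) - h|; K is to be nonempty, since [ereal_sup set0] is -oo. *)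
Definition scale_error (R : realType)
    (m : {measure set (measurableTypeR R) -> \bar R})
    (a : R -> \bar R -> R) (K : set R) (h : R) : \bar R :=
  ereal_sup [set (`| (2^-1)%:E *
      (\int[m]_(u in `](y - a h y%:E)%R, (y + a h y%:E)%R[)
         (a h y%:E - `|u - y|)%:E)
    - h%:E |)%E | y in K].

(* Main.v *)
Require Import Defs.
From HB Require Import structures.
From mathcomp Require Import all_boot all_order all_algebra.
From mathcomp Require Import finmap ring lra zify.
From mathcomp Require Import all_classical all_reals all_analysis.
From mathcomp Require Import measurable_realfun.

Set Implicit Arguments.
Unset Strict Implicit.
Unset Printing Implicit Defensive.

Import Order.TTheory GRing.Theory Num.Theory.
Import numFieldNormedType.Exports.

Local Open Scope classical_set_scope.
Local Open Scope ring_scope.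


(** The chain is embedded into the diffusion, in the manner of Skorokhod. Started
at y, the path of Y is observed until it has moved by a_h(y), then, from the
point z reached, until it has moved by a_h(z), and so on. In natural scale the
two ends of a symmetric interval are reached with probability 1/2 each, and by
the strong Markov property the path after each exit starts afresh; hence the
observed positions have the law of the chain driven by coin tosses
([expectation_embedding]). It remains to compare, on the probability space of Y,
the interpolation of the observed positions with Y itself.

The k-th position is the value of Y at the random time t_k at which it is
observed, so the comparison is one of clocks: t_k against k h. The mean duration
of a step from z is half the integral in the hypothesis on a_h, that is
h + o(h) uniformly over compact sets. Its second moment is O(h^2): the Green
function of an interval is at most twice its value at the midpoint
([integral_exit_le]), so the mean exit time is O(h) from every starting point,
and iterating the Markov property gives a geometric tail on the scale h
([exit_tail], [step_second_moment]). Over the O(1/h) steps in a bounded time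
interval the biases add up to o(1) and the variances to O(h); so t_k - k h is
small, uniformly in k, with high probability, as long as the chain stays in a
compact subset K of the interior ([clock_error_probability]).

Outside K nothing is known on the step sizes. This does no harm, by an argument
on single paths ([embedded_interpolation_cvg]). Either the path does not reach
the boundary in the time interval considered, and then it stays in some compact
set; or it reaches a boundary point at some time s, where it is absorbed. In
the second case the two clocks agree until shortly before s, and from then on
both the path and all later observations are close to the boundary point, at
whatever times they are made.

For a sequence of step sizes h_n which decreases fast enough the Borel-Cantelli
lemma turns the clock estimates into almost sure statements, for compact sets
exhausting the interior. The interpolated observations then converge to Y almost
surely, locally uniformly in time, and dominated convergence gives the
convergence of the expectations along h_n. A family which did not converge would
contain such a sequence that stays away from the limit.

The embedding is set up on the space of continuous paths, where the laws of Y
live as image measures. The chain started at a fixed y runs through a binary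
tree of deterministic positions, so all quantities attached to it are defined by
recursion over the first step, with y as a parameter; only exits from intervals
with deterministic ends occur, and a_h is never composed with a random
variable. *)

(** * Paths and the evaluation sigma-algebra *)

Section path_space.
Context {R : realType}.
Implicit Types (f : cpath R) (s t u : R) (D : set R).

Lemma to_timeK t : 0 <= t -> \val (to_time t) = t.
Proof.
by move=> t0; rewrite /to_time /insubd insubT//= inE.
Qed.

Lemma time_ge0 (t : time R) : 0 <= \val t.
Proof. by case: t => t /=; rewrite inE. Qed.

Lemma val_to_time t : \val (to_time t) = Num.max t 0.
Proof.
have [t0|t0] := leP 0 t.
  by rewrite to_timeK.
rewrite /to_time /insubd insubF//=.
by apply/negbTE; rewrite notin_setE /=; apply/negP; rewrite -ltNge.
Qed.

Lemma to_time_val (t : time R) : to_time (\val t) = t.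
Proof. by apply/val_inj; rewrite to_timeK// time_ge0. Qed.

Lemma to_time_continuous : continuous (@to_time R).
Proof.
apply: (@continuous_comp_initial (time R) R R set_val (@to_time R)).
rewrite [X in continuous X](_ : _ = fun t : R => Num.max t 0); last first.
  by apply/funext => t /=; rewrite -val_to_time.
by move=> t; apply: (@continuous_max _ _ _ _ t); [exact: cvg_id|exact: cvg_cst].
Qed.

(** Evaluation at a real time, so that statements about paths become statements
about continuous functions on the line; negative times are read as 0. *)
Definition ev f s : R := f (to_time s).

Lemma ev_val f (t : time R) : ev f (\val t) = f t.
Proof. by rewrite /ev to_time_val. Qed.

Lemma ev_continuous f : continuous (ev f).
Proof.
move=> s; apply: continuous_comp; first exact: to_time_continuous.
exact: (@cts_fun (time R) R f).
Qed.

Lemma shift_subproof s f : continuous (fun t : time R => ev f (s + \val t)).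
Proof.
move=> t; apply: (@continuous_comp (time R) R R (fun t : time R => s + \val t) (ev f) t).
  apply: (@cvgD _ _ _ (nbhs t)); [exact: cvg_cst|exact: time_val_continuous].
exact: ev_continuous.
Qed.

Definition shift_path s f : cpath R := mkcts (@shift_subproof s f).

Lemma ev_shift s f t : 0 <= t -> ev (shift_path s f) t = ev f (s + t).
Proof.
by move=> t0; rewrite -[LHS]/(ev f (s + \val (to_time t))) to_timeK.
Qed.

Lemma cpath_eq f (g : cpath R) : (forall t, 0 <= t -> ev f t = ev g t) -> f = g.
Proof.
move=> fg; apply/(@continuousEP (time R) R) => t.
by rewrite -!ev_val fg// time_ge0.
Qed.

Lemma shift_path0 f : shift_path 0 f = f.
Proof. by apply: cpath_eq => t t0; rewrite ev_shift// add0r. Qed.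

End path_space.

HB.instance Definition _ (R : realType) := Choice.on (cpath R).
HB.instance Definition _ (R : realType) := isPointed.Build (cpath R)
  (mkcts (fun t => @cst_continuous (time R) R 0 t)).

Section path_measurable.
Context {R : realType}.
Implicit Types (f : cpath R) (s t u : R) (D : set R).

Definition evaluation_sets D : set_system (cpath R) :=
  [set C | exists s B, [/\ D s, measurable B & C = [set f | B (ev f s)]]].

(** The sigma-algebra generated by the positions at the times in D: all times for
the law of a path, the times up to t for the history at time t. *)
Definition paths D := g_sigma_algebraType (evaluation_sets D).

Lemma measurable_ev D s : D s -> measurable_fun setT (fun f : paths D => ev f s).
Proof.
by move=> Ds _ B mB; rewrite setTI; apply: sub_sigma_algebra; exists s, B.
Qed.

Lemma measurable_to_paths d (T : measurableType d) D (g : T -> cpath R) :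
  (forall s, D s -> measurable_fun setT (fun x => ev (g x) s)) ->
  measurable_fun setT (g : T -> paths D).
Proof.
move=> mg; apply: (@measurability _ _ _ (paths D) _ _ (evaluation_sets D)) => //.
move=> _ [_ [s [B [Ds mB ->]]] <-].
exact: mg.
Qed.

(** Links the cylinder sets of arbitrary functions, in which the Markov property
is expressed, to events about continuous paths. *)
Lemma cylinder_trace (C : set (paths setT)) : measurable C ->
  exists2 B : set (time R -> R), cylinder_algebra B & C = [set f | B f].
Proof.
have sB : sigma_algebra setT (preimage_set_system setT
    (fun f : cpath R => (f : time R -> R)) (@cylinder_algebra R)).
  by apply: sigma_algebra_preimage; exact: smallest_sigma_algebra.
move=> mC; have [|B cB <-] := mC _ (conj sB _); last first.
  by exists B => //; rewrite setTI.
move=> _ [s [B [_ mB ->]]].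
exists [set g : time R -> R | B (g (to_time s))]; last by rewrite setTI.
by apply: sub_sigma_algebra; exists (to_time s), B.
Qed.

End path_measurable.

(** * Locally uniform convergence of interpolated paths *)

Section uniform_convergence.
Context {R : realType}.
Implicit Types (f : cpath R) (s t u : R).

(** Uniform continuity on [0, T], in a form in which the second time may lie
outside [0, T]. *)
Lemma ev_unif_continuous f T e : 0 < e ->
  exists2 dl, 0 < dl & forall s t, 0 <= s <= T -> `|s - t| < dl ->
    `|ev f s - ev f t| < e.
Proof.
move=> e0.
have /compact_near_coveringP/(_ _ (0^'+ : set_system R)
  (fun dl s => forall t, `|s - t| < dl -> `|ev f s - ev f t| < e))
  := @segment_compact R 0 T.
case.
- move=> s _.
  have /cvgrPdist_lt/(_ (e / 2)) := @ev_continuous _ f s.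
  move=> /(_ (divr_gt0 e0 (ltr0n _ 2)))/nbhs_ballP[d /= d0 fd].
  exists (ball s (d / 2), [set x | 0 < x < d / 2]) => /=.
    split; first by apply: nbhsx_ballx; rewrite divr_gt0.
    near=> x; apply/andP; split; first by near: x; exact: nbhs_right_gt.
    by near: x; apply: nbhs_right_lt; rewrite divr_gt0.
  move=> -[s' x] /= [ss' /andP[x0 xd]] t s't.
  have f1 : `|ev f s - ev f s'| < e / 2.
    apply: fd; apply: le_ball ss'; rewrite ler_pdivrMr//; lra.
  have f2 : `|ev f s - ev f t| < e / 2.
    apply: fd => /=; rewrite /ball /= in ss' *.
    rewrite (_ : s - t = (s - s') + (s' - t)); last ring.
    rewrite (le_lt_trans (ler_normD _ _))//; lra.
  rewrite (_ : _ - _ = (ev f s - ev f t) - (ev f s - ev f s')); last ring.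
  rewrite (le_lt_trans (ler_normB _ _))//; lra.
- move=> d /= d0 fd; exists (d / 2); first by rewrite divr_gt0.
  move=> s t sT; apply: (fd (d / 2)) => //=; last by rewrite divr_gt0.
  rewrite sub0r normrN gtr0_norm ?divr_gt0// ltr_pdivrMr//; lra.
Unshelve. all: by end_near. Qed.

Lemma cpath_cvg (g : nat -> cpath R) f :
  (forall T e : R, 0 < e -> \forall n \near \oo,
     forall s, 0 <= s <= T -> `|ev (g n) s - ev f s| <= e) ->
  g @ \oo --> f.
Proof.
move=> gf.
have gf' : ((fun n => (g n : {family @time_segments R, time R -> R})) @ \oo)
    --> (f : {family @time_segments R, time R -> R}).
  apply/fam_cvgP => K [a [b ->]] U /uniform_nbhs [E [entE EU]].
  have [e /= e0 eE] : exists2 e : R, 0 < e & [set xy | ball xy.1 e xy.2] `<=` E.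
    by move: entE; rewrite -entourage_ballE => -[e /= e0 eE]; exists e.
  have e20 : 0 < e / 2 by rewrite divr_gt0.
  suff gU : \forall n \near \oo, U (g n) by exact: gU.
  near=> n; apply: EU => t /= /andP[_ tb]; apply: eE => /=.
  have gfn : forall s, 0 <= s <= b -> `|ev (g n) s - ev f s| <= e / 2.
    by near: n; exact: gf.
  have e2e : e / 2 < e by rewrite ltr_pdivrMr//; lra.
  rewrite /ball /= distrC; apply: le_lt_trans e2e.
  by rewrite -!ev_val; apply: gfn; rewrite time_ge0.
move=> A [/= _ [[W oW <-] Wf sWA]].
apply: (filterS sWA); apply: gf'; exact: open_nbhs_nbhs.
Unshelve. all: by end_near. Qed.

Definition grid (n : nat) (k : int) : R := k%:~R / n.+1%:R.

Lemma grid_floor n x : `|x - grid n (Num.floor (n.+1%:R * x))| <= n.+1%:R^-1.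
Proof.
have /andP[k1 k2] := floor_itv (n.+1%:R * x).
set k := Num.floor _ in k1 k2 *.
have n0 : 0 < n.+1%:R :> R by [].
rewrite /grid -(@ler_pM2l _ n.+1%:R)// mulfV ?gt_eqF//.
rewrite -{1}(gtr0_norm n0) -normrM mulrBr (mulrC _ (k%:~R / _)) divfK ?gt_eqF//.
rewrite ger0_norm ?subr_ge0//; rewrite intrD in k2; lra.
Qed.

(** An interpolated value is a convex combination of the two values at the
neighbouring grid points. *)
Lemma interpolation_near (h : R) (x : nat -> R) s v e : 0 < h -> 0 <= s ->
  `|x (Num.truncn (s / h)) - v| <= e -> `|x (Num.truncn (s / h)).+1 - v| <= e ->
  `|ev (interpolation h x) s - v| <= e.
Proof.
move=> h0 s0; rewrite -[ev _ _]/(interpolate x (\val (to_time s) / h)) to_timeK//.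
rewrite /interpolate; set k := Num.truncn _ => x1 x2.
have sh0 : 0 <= s / h by rewrite divr_ge0// ltW.
have /andP[k1] := truncn_itv sh0; rewrite -/k -natr1 => k2.
set p := s / h - _; have [p0 p1] : 0 <= p /\ p <= 1 by rewrite /p; lra.
rewrite (_ : _ - v = (1 - p) * (x k - v) + p * (x k.+1 - v)); last ring.
rewrite (le_trans (ler_normD _ _))// !normrM (ger0_norm p0) ger0_norm ?subr_ge0//.
have : (1 - p) * `|x k - v| <= (1 - p) * e by rewrite ler_wpM2l ?subr_ge0.
have : p * `|x k.+1 - v| <= p * e by rewrite ler_wpM2l.
lra.
Qed.

End uniform_convergence.

(** * Measurability of continuous path functionals *)

Section path_functionals.
Context {R : realType} d (T : measurableType d).

Lemma measurable_countable_selection (K : countType) d' (T' : measurableType d')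
    (c : T -> K) (G : K -> T -> T') :
  (forall k, measurable [set x | c x = k]) ->
  (forall k, measurable_fun setT (G k)) ->
  measurable_fun setT (fun x => G (c x) x).
Proof.
move=> mc mG _ B mB; rewrite setTI.
rewrite (_ : _ @^-1` B = \bigcup_k ([set x | c x = k] `&` G k @^-1` B)).
  apply: countable_bigcupT_measurable; first exact: countableP.
  by move=> k; apply: measurableI => //; rewrite -[X in measurable X]setTI; exact: mG.
apply/seteqP; split=> [x Bx|x [k _ [/= <-]]//].
by exists (c x).
Qed.

Lemma measurable_floor_eq (g : T -> R) k : measurable_fun setT g ->
  measurable [set x | Num.floor (g x) = k].
Proof.
move=> mg; rewrite (_ : mkset _ = g @^-1` `[k%:~R, (k + 1)%:~R[%classic).
  by rewrite -[X in measurable X]setTI; apply: mg => //; exact: measurable_itv.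
by apply/seteqP; split=> x /=; rewrite in_itv /= -floor_eq; [move=> ->|move/eqP].
Qed.

Lemma cvg_invn : (n.+1%:R^-1 : R) @[n --> \oo] --> 0.
Proof. exact: cvg_harmonic. Qed.

(** The random time is the limit of its roundings, each of which has countably
many values; continuity of the path passes to the limit. *)
Lemma measurable_ev_random (g : T -> cpath R) (r : T -> R) :
  (forall s, measurable_fun setT (fun x => ev (g x) s)) ->
  measurable_fun setT r -> measurable_fun setT (fun x => ev (g x) (r x)).
Proof.
move=> mg mr.
apply: (@measurable_fun_cvg _ _ _ _
  (fun n x => ev (g x) (grid n (Num.floor (n.+1%:R * r x))))).
- move=> n; apply: (@measurable_countable_selection _ _ _
    (fun x => Num.floor (n.+1%:R * r x)) (fun k x => ev (g x) (grid n k))) => k.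
    by apply: measurable_floor_eq; exact: measurable_funM.
  exact: mg.
- move=> x _; apply: (@cvg_comp _ _ _ (fun n => grid n (Num.floor (n.+1%:R * r x)))
    (ev (g x))); last exact: ev_continuous.
  apply/cvgrPdist_le => e e0.
  have := cvg_invn; move/cvgrPdist_le => /(_ _ e0); apply: filterS => n.
  rewrite sub0r normrN ger0_norm// => ne.
  exact: (le_trans (grid_floor _ _)).
Qed.

(** The path with the values c_k / (n+1) at the times k / (n+1), for k up to
(n+1)^2, and constant afterwards. The times reach up to n+1, and a code is a
list of integers, so that there are only countably many codes. *)
Definition grid_path n (c : seq int) : cpath R :=
  interpolation n.+1%:R^-1 (fun k => grid n (nth 0 c (minn k (n.+1 ^ 2)%N))).

(** The default value in [grid_path] is never read on such a list: it has
(n+1)^2 + 1 entries. *)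
Definition grid_code n (f : cpath R) : seq int :=
  [seq Num.floor (n.+1%:R * ev f (k%:R / n.+1%:R)) | k <- iota 0 (n.+1 ^ 2).+1].

Lemma grid_path_cvg f : (fun n => grid_path n (grid_code n f)) @ \oo --> f.
Proof.
apply: cpath_cvg => t e e0.
have e20 : 0 < e / 2 by rewrite divr_gt0.
have [dl dl0 fdl] := ev_unif_continuous f t e20.
near=> n => s /andP[s0 st].
have n0 : 0 < n.+1%:R :> R by [].
have near_s k : `|s - k%:R / n.+1%:R| <= n.+1%:R^-1 -> (k <= n.+1 ^ 2)%N ->
    `|grid n (nth 0 (grid_code n f) (minn k (n.+1 ^ 2))) - ev f s| <= e.
  move=> sk kn; rewrite (minn_idPl kn) (nth_map 0%N) ?size_iota ?ltnS//.
  rewrite nth_iota ?ltnS// add0n.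
  have g1 := grid_floor n (ev f (k%:R / n.+1%:R)).
  have g2 : `|ev f s - ev f (k%:R / n.+1%:R)| < e / 2.
    apply: fdl; first by rewrite s0.
    by apply: le_lt_trans sk _; near: n; exact: (cvgr_lt _ cvg_invn).
  have g3 : n.+1%:R^-1 <= e / 2 by near: n; exact: (cvgr_le _ cvg_invn).
  rewrite distrC (le_trans (ler_distD (ev f (k%:R / n.+1%:R)) _ _))//.
  by rewrite (le_trans (lerD (ltW g2) g1))// [leRHS]splitr lerD2l.
have tn : t + 1 <= n.+1%:R.
  near: n; have := nbhs_infty_ger (t + 1); apply: filterS => n /le_trans; apply.
  by rewrite ler_nat.
have sn0 : 0 <= s / n.+1%:R^-1 by rewrite invrK mulr_ge0.
have := truncn_itv sn0; rewrite invrK; set k := Num.truncn _ => /andP[k1].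
rewrite -[k.+1%:R]natr1 => k2; have {}k1 : k%:R <= s * n.+1%:R := k1.
have kn : (k.+1 <= n.+1 ^ 2)%N.
  rewrite -(ler_nat R) -[k.+1%:R]natr1 natrX expr2.
  have : s * n.+1%:R <= t * n.+1%:R by rewrite ler_wpM2r.
  have : (t + 1) * n.+1%:R <= n.+1%:R * n.+1%:R by rewrite ler_wpM2r.
  have : 1 <= n.+1%:R :> R by rewrite ler1n.
  lra.
have sE : s = (s * n.+1%:R) / n.+1%:R by rewrite mulfK// gt_eqF.
apply: interpolation_near; rewrite ?invr_gt0// invrK -/k; apply: near_s => //.
- rewrite {1}sE -mulrBl normrM (@gtr0_norm _ n.+1%:R^-1) ?invr_gt0//.
  rewrite -[leRHS]mul1r ler_wpM2r ?invr_ge0// ler_norml; lra.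
- exact: ltnW.
- rewrite {1}sE -mulrBl normrM (@gtr0_norm _ n.+1%:R^-1) ?invr_gt0//.
  rewrite -[leRHS]mul1r ler_wpM2r ?invr_ge0// ler_norml -[k.+1%:R]natr1; lra.
Unshelve. all: by end_near. Qed.

(** F is the pointwise limit of its values at the grid approximations, and those
are functions of a measurable code with countably many values. *)
Lemma measurable_continuous_functional (F : cpath R -> R) (g : T -> cpath R) :
  continuous F -> (forall s, measurable_fun setT (fun x => ev (g x) s)) ->
  measurable_fun setT (F \o g).
Proof.
move=> cF mg.
apply: (@measurable_fun_cvg _ _ _ _
  (fun n x => F (grid_path n (grid_code n (g x))))); last first.
  move=> x _; apply: (@cvg_comp _ _ _ (fun n => grid_path n (grid_code n (g x))) F).
    exact: grid_path_cvg.
  exact: cF.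
move=> n; apply: (@measurable_countable_selection _ _ _
    (fun x => grid_code n (g x)) (fun c x => F (grid_path n c))) => [c|c]; last first.
  exact: measurable_cst.
rewrite /grid_code; elim: (iota _ _) c => [|k l ih] c /=.
  have [->|c0] := eqVneq c [::].
    by rewrite (_ : mkset _ = setT)//; apply/seteqP; split.
  rewrite (_ : mkset _ = set0)//; apply/seteqP; split => // x /= c0'.
  by rewrite -c0' eqxx in c0.
case: c => [|b c].
  by rewrite (_ : mkset _ = set0)//; apply/seteqP; split.
rewrite (_ : mkset _ = [set x | Num.floor (n.+1%:R * ev (g x) (k%:R / n.+1%:R)) = b]
  `&` [set x | [seq Num.floor (n.+1%:R * ev (g x) (k%:R / n.+1%:R)) | k <- l] = c]).
  by apply: measurableI; [apply: measurable_floor_eq; exact: measurable_funM|exact: ih].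
by apply/seteqP; split=> x /= [-> ->].
Qed.

End path_functionals.

(** * Hitting times and exit times of a path *)

Section hitting.
Context {R : realType}.
Implicit Types (f : cpath R) (x s t u : R) (D : set R).

Definition hit x t f : Prop := exists2 s, 0 <= s <= t & ev f s = x.

(** The distance to x attains its minimum over [0, t]. *)
Lemma hit_near x t f : 0 <= t ->
  (forall n : nat, exists2 s, 0 <= s <= t & `|ev f s - x| < n.+1%:R^-1) ->
  hit x t f.
Proof.
move=> t0 fx.
have cf : {within `[0, t], continuous (fun s => `|ev f s - x|)}.
  apply: continuous_subspaceT => s; apply: cvg_norm; apply: cvgB.
    exact: ev_continuous.
  exact: cvg_cst.
have [c] := EVT_min t0 cf; rewrite in_itv /= => c0t cmin.
exists c => //; apply/eqP; rewrite -subr_eq0 -normr_le0 leNgt; apply/negP => c0.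
have [n nc] : exists n : nat, n.+1%:R^-1 < `|ev f c - x|.
  have [n _ nP] := (cvgr_lt _ cvg_invn) _ c0.
  by exists n; exact: nP (leqnn n).
have [s s0t sn] := fx n; have := cmin s; rewrite in_itv => /(_ s0t) cs.
by have := lt_trans (le_lt_trans cs sn) nc; rewrite ltxx.
Qed.

(** The set of times at which a continuous path is at x is closed, so its infimum
is attained. *)
Lemma hit_right x t f : 0 <= t -> (forall e, 0 < e -> hit x (t + e) f) ->
  hit x t f.
Proof.
move=> t0 fx; apply: hit_near => // n.
have n0 : 0 < n.+1%:R^-1 :> R by rewrite invr_gt0.
have /cvgrPdist_lt/(_ _ n0)/nbhs_ballP[e /= e0 fe] := @ev_continuous _ f t.
have e20 : 0 < e / 2 by rewrite divr_gt0.
have [s /andP[s0 st] fs] := fx _ e20.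
have [st'|ts] := leP s t.
  by exists s; rewrite ?s0// fs subrr normr0.
exists t; first by rewrite t0 lexx.
rewrite -fs; apply: fe; rewrite /ball /= ltr_norml; lra.
Qed.

Lemma le_hit x s t f : s <= t -> hit x s f -> hit x t f.
Proof.
by move=> st [u /andP[u0 us] fu]; exists u; rewrite // u0 (le_trans us).
Qed.

(** By [hit_near] it is enough to come arbitrarily close to x, and for that
countably many times suffice: the rational numbers, moved into [0, t] so that
only times of D are used. *)
Lemma measurable_hit D x t : [set s | 0 <= s <= t] `<=` D ->
  measurable ([set f | hit x t f] : set (paths D)).
Proof.
move=> tD; have [t0|t0] := ltP t 0.
  rewrite (_ : mkset _ = set0)//; apply/seteqP; split => // f /= [s].
  by move=> /andP[s0 st]; have := lt_le_trans t0 s0; rewrite ltNge st.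
pose c (q : rat) : R := Num.max 0 (Num.min t (ratr q)).
have c0t q : 0 <= c q <= t.
  by rewrite le_max lexx /= ge_max t0 ge_min lexx.
rewrite (_ : mkset _ = \bigcap_(n : nat) \bigcup_(q : rat)
  [set f : paths D | `|ev f (c q) - x| < n.+1%:R^-1]).
  apply: bigcapT_measurable => n; apply: bigcupT_measurable_rat => q.
  rewrite (_ : mkset _ = (fun f : paths D => ev f (c q)) @^-1`
    (ball x n.+1%:R^-1)).
    rewrite -[X in measurable X]setTI; apply: measurable_ev => //.
    - exact/tD/c0t.
    - exact: measurable_ball.
  by apply/seteqP; split => f /=; rewrite /ball /= distrC.
apply/seteqP; split => f.
  move=> [s s0t fs] n _ /=.
  have cc : {for s, continuous (fun u => ev f (Num.max 0 (Num.min t u)))}.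
    apply: (@continuous_comp _ _ _ _ (ev f)); last exact: ev_continuous.
    apply: (@continuous_max _ _ _ _ s); first exact: cvg_cst.
    by apply: (@continuous_min _ _ _ _ s); [exact: cvg_cst|exact: cvg_id].
  have n0 : 0 < n.+1%:R^-1 :> R by rewrite invr_gt0.
  have /cvgrPdist_lt/(_ _ n0)/nbhs_ballP[e /= e0 fe] := cc.
  have /rat_in_itvoo[q] : s < s + e by rewrite ltrDl.
  rewrite in_itv /= => /andP[sq qs]; exists q => //=.
  have sE : Num.max 0 (Num.min t s) = s.
    by move/andP: s0t => [s0 st]; rewrite min_r// max_r.
  have := fe (ratr q); rewrite /ball /= sE -/(c q) fs (distrC x); apply.
  rewrite ltr_norml; lra.
move=> fx; apply: hit_near => // n; have [q _ /= fq] := fx n I.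
by exists (c q).
Qed.

Lemma hitting_time_ge0 (x : \bar R) f : (0 <= hitting_time x f)%E.
Proof.
by apply: le_ereal_inf_tmp => _ [t _ <-]; rewrite lee_fin time_ge0.
Qed.

Lemma hitting_time_le x t f : 0 <= t ->
  (hitting_time x%:E f <= t%:E)%E <-> hit x t f.
Proof.
move=> t0; split=> [ht|[s /andP[s0 st] fs]].
  apply: hit_right => // e e0.
  have /ereal_inf_lt[_ [s /= [fs] <-]] : (hitting_time x%:E f < (t + e)%:E)%E.
    by rewrite (le_lt_trans ht)// lte_fin ltrDl.
  rewrite lte_fin => /ltW st; exists (\val s); first by rewrite time_ge0.
  by rewrite ev_val.
rewrite (@le_trans _ _ s%:E) ?lee_fin//; apply: ereal_inf_lbound.
by exists (to_time s); rewrite ?to_timeK//=; congr EFin.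
Qed.

Lemma hitting_time_fin x f : (hitting_time x%:E f < +oo)%E ->
  hitting_time x%:E f \is a fin_num.
Proof. by rewrite ge0_fin_numE// hitting_time_ge0. Qed.

Lemma ev_hitting_time x f : (hitting_time x%:E f < +oo)%E ->
  ev f (fine (hitting_time x%:E f)) = x.
Proof.
move=> hx; have hf := hitting_time_fin hx.
set s := fine _; have s0 : 0 <= s by rewrite fine_ge0// hitting_time_ge0.
have sE : hitting_time x%:E f = s%:E by rewrite fineK.
have /(hitting_time_le x f s0)[u /andP[u0 us] fu] : (hitting_time x%:E f <= s%:E)%E.
  by rewrite sE.
suff -> : s = u by [].
apply/eqP; rewrite eq_le us andbT -lee_fin -sE; apply/hitting_time_le => //.
by exists u; rewrite // u0 lexx.
Qed.

Lemma measurable_ereal_fun d (T : measurableType d) (g : T -> \bar R) :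
  (forall w, 0 <= g w)%E ->
  (forall t, 0 <= t -> measurable [set w | g w <= t%:E]%E) ->
  measurable_fun setT g.
Proof.
move=> g0 mg mT; apply: (measurability _ (ErealGenOInfty.measurableE R)) => //.
move=> _ [_ [t ->] <-]; rewrite setTI.
rewrite (_ : _ @^-1` _ = ~` [set w | g w <= t%:E]%E); last first.
  apply/seteqP; split => w /=; rewrite in_itv /= andbT ltNge => /negP //.
apply: measurableC; have [t0|t0] := leP 0 t; first exact: mg.
rewrite (_ : mkset _ = set0)//; apply/seteqP; split => // w /= gt.
by have := le_trans (g0 w) gt; rewrite lee_fin leNgt t0.
Qed.

Lemma measurable_hitting_time x :
  measurable_fun setT (hitting_time x%:E : paths (@setT R) -> \bar R).
Proof.
apply: measurable_ereal_fun => [f|t t0]; first exact: hitting_time_ge0.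
rewrite (_ : mkset _ = [set f | hit x t f]); first exact: measurable_hit.
by apply/seteqP; split => f /= /hitting_time_le; apply.
Qed.

Definition exit (a b : R) f : \bar R := hitting_time2 a%:E b%:E f.

Lemma exit_ge0 a b f : (0 <= exit a b f)%E.
Proof. by rewrite le_min !hitting_time_ge0. Qed.

Lemma measurable_exit a b :
  measurable_fun setT (exit a b : paths (@setT R) -> \bar R).
Proof. by apply: measurable_mine; exact: measurable_hitting_time. Qed.

(** The path leaves (a, b) through b. The value is also true when neither end is
ever reached, which will be a null event. *)
Definition exits_up (a b : R) f : bool :=
  (hitting_time b%:E f <= hitting_time a%:E f)%E.

Lemma measurable_exits_up a b :
  measurable_fun setT (exits_up a b : paths (@setT R) -> bool).
Proof.
by apply: measurable_fun_lee; exact: measurable_hitting_time.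
Qed.

Lemma ev_exit a b f : (exit a b f < +oo)%E ->
  ev f (fine (exit a b f)) = if exits_up a b f then b else a.
Proof.
rewrite /exits_up /exit /hitting_time2; case: ifPn => [hba|].
  by rewrite min_r// => /ev_hitting_time.
by rewrite -ltNge => /ltW hab; rewrite min_l// => /ev_hitting_time.
Qed.

Definition stop t f : cpath R :=
  mkcts (fun s : time R => (@continuous_comp (time R) R R
   (fun s : time R => Num.min t (\val s)) (ev f) s
   (@continuous_min _ _ _ _ s (@cst_continuous _ _ t s) (@time_val_continuous R s))
   (@ev_continuous _ f _))).

Lemma ev_stop t f s : 0 <= s -> ev (stop t f) s = ev f (Num.min t s).
Proof.
by move=> s0; rewrite -[LHS]/(ev f (Num.min t (\val (to_time s)))) to_timeK.
Qed.

(** Stopping at time t erases exactly the visits after time t. *)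
Lemma hitting_time_stop x t f : 0 <= t -> hitting_time x%:E (stop t f) =
  if (hitting_time x%:E f <= t%:E)%E then hitting_time x%:E f else +oo%E.
Proof.
move=> t0.
have hitE s : 0 <= s -> hit x s (stop t f) <-> hit x (Num.min t s) f.
  move=> s0; split=> -[u /andP[u0 us] fu].
    exists (Num.min t u); last by rewrite -ev_stop.
    by rewrite le_min t0 u0 /= le_min2.
  exists u; rewrite ?u0 ?(le_trans us) ?ge_min ?lexx ?orbT//.
  by rewrite ev_stop// min_r// (le_trans us)// ge_min lexx.
apply/eqP; rewrite eq_le; apply/andP; split.
  case: ifPn => [ht|_]; last by rewrite leey.
  have hf : hitting_time x%:E f \is a fin_num.
    by apply: hitting_time_fin; rewrite (le_lt_trans ht)// ltry.
  have h0 := fine_ge0 (hitting_time_ge0 x%:E f).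
  rewrite -(fineK hf); apply/hitting_time_le => //; apply/hitE => //.
  rewrite min_r; last by rewrite -lee_fin fineK.
  by apply/hitting_time_le => //; rewrite fineK.
case: (ltP (hitting_time x%:E (stop t f)) +oo%E) => [hs|]; last first.
  by rewrite leye_eq => /eqP ->; rewrite leey.
have hf := hitting_time_fin hs.
have h0 := fine_ge0 (hitting_time_ge0 x%:E (stop t f)).
have : hit x (fine (hitting_time x%:E (stop t f))) (stop t f).
  by apply/hitting_time_le => //; rewrite fineK.
move=> /hitE => /(_ h0) hmin.
have -> : (hitting_time x%:E f <= t%:E)%E.
  by apply/hitting_time_le => //; apply: le_hit hmin; rewrite ge_min lexx.
rewrite -[leRHS](fineK hf); apply/hitting_time_le => //.
by apply: le_hit hmin; rewrite ge_min lexx orbT.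
Qed.

Lemma exit_stop a b t f : 0 <= t -> exit a b (stop t f) =
  if (exit a b f <= t%:E)%E then exit a b f else +oo%E.
Proof.
move=> t0; rewrite /exit /hitting_time2 !hitting_time_stop// ge_min.
set u := hitting_time _ f; set v := hitting_time b%:E f.
have [ut|tu] /= := leP u t%:E; have [vt|tv] //= := leP v t%:E.
- by rewrite min_l ?leey// min_l// (le_trans ut)// ltW.
- by rewrite min_r ?leey// min_r// (le_trans vt)// ltW.
Qed.

Lemma exits_up_stop a b t f : 0 <= t -> (exit a b f <= t%:E)%E ->
  exits_up a b (stop t f) = exits_up a b f.
Proof.
move=> t0; rewrite /exit /hitting_time2 /exits_up !hitting_time_stop// ge_min.
set u := hitting_time _ f; set v := hitting_time b%:E f.
have [ut|tu] /= := leP u t%:E; have [vt|tv] //= := leP v t%:E.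
- move=> _; rewrite leye_eq lt_eqF ?(le_lt_trans ut) ?ltry//.
  by apply/esym/negbTE; rewrite -ltNge (le_lt_trans ut).
- by move=> _; rewrite leey (le_trans vt)// ltW.
Qed.

(** Galmarino's test: an event that cannot tell a path from the path stopped at
time t is determined by the history up to time t. *)
Lemma measurable_stop_invariant t (Z : set (paths (@setT R))) :
  0 <= t -> measurable Z -> (forall f, Z f <-> Z (stop t f)) ->
  measurable (Z : set (paths [set s | s <= t])).
Proof.
move=> t0 mZ Zt; have -> : Z = (stop t @^-1` Z) by apply/seteqP; split => [f /Zt //|f zf]; exact/Zt.
have ms : measurable_fun setT
    (stop t : paths [set s | s <= t] -> paths (@setT R)).
  apply: measurable_to_paths => s _.
  have -> : (fun f => ev (stop t f) s) =
      (fun f : paths [set s | s <= t] => ev f (Num.min t (Num.max s 0))).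
    apply/funext => f; rewrite -ev_stop ?le_max ?lexx ?orbT//.
    by rewrite /ev; congr (stop t f _); apply: val_inj; rewrite !val_to_time [RHS]max_l // le_max lexx orbT.
  by apply: measurable_ev => /=; rewrite ge_min lexx.
by rewrite -[X in measurable X]setTI; exact: ms.
Qed.

End hitting.

(** * The laws of the diffusion on path space *)

Notation path_space R := (paths (@setT R)).

Section measure_lemmas.
Context {R : realType} {d : measure_display} {T : measurableType d}.

Lemma measurable_shift_random (g : T -> path_space R) (r : T -> R) :
  measurable_fun setT g -> measurable_fun setT r ->
  measurable_fun setT (fun x => shift_path (r x) (g x) : path_space R).
Proof.
move=> mg mr; apply: measurable_to_paths => s _.
rewrite (_ : (fun _ => _) = fun x => ev (g x) (r x + Num.max s 0)); last first.
  by apply/funext => x; rewrite -val_to_time.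
apply: measurable_ev_random; last exact: measurable_funD.
move=> u; apply: (measurableT_comp (@measurable_ev _ setT u I) mg).
Qed.

Lemma probability_setI1 (P : probability T R) (A B : set T) :
  measurable A -> measurable B -> P A = 1%E -> P (A `&` B) = P B.
Proof.
move=> mA mB PA.
have mD : measurable (B `\` A) by exact: measurableD.
have : P (B `\` A) = 0%E.
  apply/eqP; rewrite -measure_le0 (@le_trans _ _ (P (~` A)))//.
    apply: le_measure; rewrite ?inE//; exact: measurableC.
  by rewrite probability_setC// PA subee.
move=> D0; rewrite [in RHS](_ : B = (B `\` A) `|` (A `&` B)); last first.
  by rewrite setUC setIC setUIDK.
have mAB : measurable (A `&` B) by exact: measurableI.
have BA0 : (B `\` A) `&` (A `&` B) = set0.
  by apply/seteqP; split => // x [[_ nA] [Ax _]]; exact: nA.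
rewrite measureU//.
by rewrite [X in (X + _)%E]D0 add0e.
Qed.

End measure_lemmas.

Section path_law.
Context {R : realType} {I : set R} {l r : \bar R}.
Context {d : measure_display} {Omega : measurableType d}.
Context {Ft : time R -> set_system Omega} {Py : R -> probability Omega R}.
Context {Y : Omega -> cpath R} {m : {measure set (measurableTypeR R) -> \bar R}}.
Hypothesis diffY : general_diffusion I l r Py Ft Y m.

Let csm := gd_process diffY.

Lemma diffusion_measurable : measurable_fun setT (Y : Omega -> path_space R).
Proof.
apply: measurable_to_paths => s _ _ B mB; rewrite setTI.
apply: (filtration_measurable (csm_filtration csm)).
exact: (csm_adapted csm (to_time s) mB).
Qed.

Definition path_law (y : R) : probability (path_space R) R :=
  distribution (Py y) (mfun_Sub (mem_set diffusion_measurable)).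

Lemma path_lawE y B : path_law y B = Py y (Y @^-1` B).
Proof. by []. Qed.

(** The events of Omega determined by Y up to time t belong to the filtration at
time t, so that stopping times can be verified on path space. *)
Lemma adapted_preimage (t : time R) (Z : set (paths [set s | s <= \val t])) :
  measurable Z -> Ft t (Y @^-1` Z).
Proof.
move=> mZ.
have sF := filtration_sigma_algebra (csm_filtration csm) t.
suff: image_set_system setT Y (Ft t) Z by rewrite /image_set_system /= setTI.
apply: mZ; split; first exact: sigma_algebra_image.
move=> _ [s [B [/= st mB ->]]]; rewrite /image_set_system /= setTI.
have [F1 _ F3] := csm_filtration csm.
apply: (F3 (to_time s)); last exact: (csm_adapted csm).
by rewrite val_to_time ge_max st time_ge0.
Qed.

Lemma stopping_exit a b : stopping_time Ft (fun w => exit a b (Y w)).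
Proof.
split=> [w|t]; first exact: exit_ge0.
apply: (@adapted_preimage t [set f | exit a b f <= (\val t)%:E]%E).
apply: measurable_stop_invariant; first exact: time_ge0.
  rewrite -[X in measurable X]setTI.
  by apply: (@emeasurable_fun_infty_c _ _ R setT) => //; exact: measurable_exit.
move=> f /=; rewrite exit_stop ?time_ge0//.
by case: ifPn => [//|et]; split => [h|]; [case/negP: et|rewrite leye_eq].
Qed.

Definition exit_event a b (S : set (\bar R)) e : set (path_space R) :=
  [set f | [/\ exit a b f < +oo, S (exit a b f) & exits_up a b f = e]%E].

Lemma measurable_exit_event a b S e : measurable S ->
  measurable (exit_event a b S e).
Proof.
move=> mS; rewrite (_ : exit_event _ _ _ _ = [set f | exit a b f < +oo]%E `&`
  (exit a b @^-1` S `&` exits_up a b @^-1` [set e])); last first.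
  by apply/seteqP; split=> f /= [// ? [? ?]].
apply: measurableI.
  rewrite -[X in measurable X]setTI.
  by apply: (@emeasurable_fun_infty_o _ _ R setT) => //; exact: measurable_exit.
apply: measurableI; rewrite -[X in measurable X]setTI.
  exact: measurable_exit.
exact: measurable_exits_up.
Qed.

(** On the event that the exit takes place through a given end, the kernel in the
strong Markov property is evaluated at that end only; its integral becomes a
product. The set S keeps track of the exit time, so that the rest of the path is
independent of it. *)
Lemma strong_markov_exit c a b S e (B : set (path_space R)) :
  I c -> measurable S -> measurable B ->
  path_law c (exit_event a b S e `&` [set f | B (shift_path (fine (exit a b f)) f)]) =
  (path_law c (exit_event a b S e) * path_law (if e then b else a) B)%E.
Proof.
move=> Ic mS mB; have [C cC ->] := cylinder_trace mB.
set Z := exit_event a b S e.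
have mZ : measurable Z by exact: measurable_exit_event.
have mYZ : measurable (Y @^-1` Z).
  by rewrite -[X in measurable X]setTI; exact: diffusion_measurable.
have ZE : Y @^-1` Z `&` [set w | exit a b (Y w) < +oo]%E = Y @^-1` Z.
  by apply/setIidPl => w [].
have stA : stopped_algebra Ft (fun w => exit a b (Y w)) (Y @^-1` Z).
  split=> // t.
  apply: (@adapted_preimage t (Z `&` [set f | exit a b f <= (\val t)%:E]%E)).
  apply: measurable_stop_invariant; first exact: time_ge0.
    apply: measurableI => //; rewrite -[X in measurable X]setTI.
    by apply: (@emeasurable_fun_infty_c _ _ R setT) => //; exact: measurable_exit.
  move=> f /=; rewrite /Z /exit_event /= exit_stop ?time_ge0//.
  case: ifPn => [et|/negP et].
    by rewrite exits_up_stop ?time_ge0//; split => -[? _]; split.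
  by rewrite leye_eq; split => -[].
have := csm_strong_markov csm Ic (stopping_exit a b) stA cC.
rewrite ZE => markov.
rewrite [LHS]path_lawE [X in (_ * X)%E]path_lawE.
transitivity (Py c (Y @^-1` Z `&`
  [set w | C (shifted (fun w => exit a b (Y w)) Y w)])); first by [].
rewrite markov muleC -(integral_cst (Py c) mYZ); apply: eq_integral => w.
rewrite inE => -[eoo _ eu] /=; congr (Py _ _).
by rewrite -[Y w _]/(ev (Y w) (fine (exit a b (Y w)))) ev_exit// eu.
Qed.

Lemma path_law_start c : I c -> path_law c [set f | ev f 0 = c] = 1%E.
Proof.
move=> Ic; rewrite path_lawE -[RHS](csm_start csm Ic); congr (Py c _).
apply/seteqP; split=> w /=; rewrite /ev.
  by have -> : to_time (0 : R) = time0 R by apply: val_inj; rewrite to_timeK.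
by have -> : to_time (0 : R) = time0 R by apply: val_inj; rewrite to_timeK.
Qed.

Lemma measurable_exit_gt a b (t : \bar R) :
  measurable ([set f | t < exit a b f]%E : set (path_space R)).
Proof.
rewrite (_ : mkset _ = ~` [set f | exit a b f <= t]%E); last first.
  by apply/seteqP; split => f /=; rewrite ltNge => /negP.
apply: measurableC; rewrite -[X in measurable X]setTI.
by apply: (@emeasurable_fun_infty_c _ _ R setT) => //; exact: measurable_exit.
Qed.

Lemma measurable_ev_eq s x : measurable ([set f | ev f s = x] : set (path_space R)).
Proof.
rewrite (_ : mkset _ = (fun f : path_space R => ev f s) @^-1` [set x])//.
by rewrite -[X in measurable X]setTI; exact: measurable_ev.
Qed.

Lemma inside_before_exit (a b t : R) (f : cpath R) : 0 <= t -> a < ev f 0 < b ->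
  (t%:E < exit a b f)%E -> a < ev f t < b.
Proof.
move=> t0 /andP[a0 b0]; rewrite /exit lt_min => /andP[ha hb].
have cf : {within `[0, t], continuous (ev f)}.
  by apply: continuous_subspaceT; exact: ev_continuous.
apply/andP; split; rewrite ltNge; apply/negP => fx.
  have [|c] := IVT t0 cf (_ : _ <= a <= _).
    by rewrite ge_min le_max (ltW a0) fx orbT.
  rewrite in_itv /= => c0t ca; move: ha; rewrite ltNge => /negP; apply.
  by apply/hitting_time_le => //; exists c.
have [|c] := IVT t0 cf (_ : _ <= b <= _).
  by rewrite ge_min le_max (ltW b0) fx orbT.
rewrite in_itv /= => c0t cb; move: hb; rewrite ltNge => /negP; apply.
by apply/hitting_time_le => //; exists c.
Qed.

(** Before the exit the position lies in (a, b), hence a bound that is uniform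
over the starting points in (a, b) applies to the path after time t. *)
Lemma markov_before_exit (c a b t : R) (B : set (path_space R)) (p : R) :
  I c -> a < c < b -> 0 <= t -> 0 <= p -> measurable B ->
  (forall z, I z -> a < z < b -> (path_law z B <= p%:E)%E) ->
  (path_law c ([set f | t%:E < exit a b f]%E `&` [set f | B (shift_path t f)]) <=
   p%:E * path_law c [set f | t%:E < exit a b f]%E)%E.
Proof.
move=> Ic acb t0 p0 mB Bp; have [C cC BE] := cylinder_trace mB.
pose Z : set (path_space R) := [set f | ev f 0 = c] `&` [set f | t%:E < exit a b f]%E.
have mZ : measurable Z.
  by apply: measurableI; [exact: measurable_ev_eq|exact: measurable_exit_gt].
have mYZ : measurable (Y @^-1` Z).
  by rewrite -[X in measurable X]setTI; exact: diffusion_measurable.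
have [F1 F2 F3] := csm_filtration csm.
have st : stopping_time Ft (fun=> t%:E).
  split=> [w|s]; first by rewrite lee_fin.
  have [F10 F1C _] := F1 s.
  have [ts|ts] := leP t (\val s).
    rewrite (_ : mkset _ = setT `\` set0); first exact: F1C.
    by rewrite setD0; apply/seteqP; split => // w _ /=; rewrite lee_fin.
  rewrite (_ : mkset _ = set0)//; apply/seteqP; split => // w /=.
  by rewrite lee_fin leNgt ts.
have FtZ : Ft (to_time t) (Y @^-1` Z).
  apply: adapted_preimage; apply: measurable_stop_invariant => //.
    exact: time_ge0.
  rewrite to_timeK// => f; have e0 : ev (stop t f) 0 = ev f 0.
    by rewrite ev_stop// min_r.
  rewrite /Z /setI /mkset e0 exit_stop//.
  case: ifPn => [et|]; first by rewrite ltNge et; split => -[].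
  rewrite -ltNge => tex; split => -[-> _]; split => //.
  by rewrite ltry.
have stA : stopped_algebra Ft (fun=> t%:E) (Y @^-1` Z).
  split=> // s.
  have [F10 F1C _] := F1 s.
  have [ts|ts] := leP t (\val s).
    rewrite (_ : [set _ | _] = setT) ?setIT; last first.
      by apply/seteqP; split => // w _ /=; rewrite lee_fin.
    by apply: (F3 (to_time t)) => //; rewrite to_timeK.
  rewrite (_ : [set _ | _] = set0) ?setI0//; apply/seteqP; split => // w /=.
  by rewrite lee_fin leNgt ts.
have := csm_strong_markov csm Ic st stA cC.
rewrite (_ : [set _ | (t%:E < +oo)%E] = setT) ?setIT; last first.
  by apply/seteqP; split => // w _ /=; rewrite ltry.
move=> markov.
have ZE : path_law c ([set f | t%:E < exit a b f]%E `&` [set f | B (shift_path t f)]) =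
   path_law c (Z `&` [set f | B (shift_path t f)]).
  rewrite /Z -setIA [RHS]probability_setI1//.
  - exact: measurable_ev_eq.
  - apply: measurableI; first exact: measurable_exit_gt.
    rewrite -[X in measurable X]setTI.
    exact: (measurable_shift_random (@measurable_id _ _ _) (@measurable_cst _ _ _ _ _ t)).
  - exact: path_law_start.
rewrite ZE path_lawE.
have -> : Y @^-1` (Z `&` [set f | B (shift_path t f)]) =
  (Y @^-1` Z `&` [set w | C (shifted (fun=> t%:E) Y w)]).
  by rewrite BE.
rewrite markov.
apply: (@le_trans _ _ (p%:E * Py c (Y @^-1` Z))%E); last first.
  rewrite lee_wpmul2l// path_lawE le_measure ?inE//.
  - by rewrite -[X in measurable X]setTI; apply: diffusion_measurable => //; exact: measurable_exit_gt.
  - by move=> w [].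
rewrite -integral_cst//; apply: ge0_le_integral => //.
- have mI : measurable I by apply: is_interval_measurable; exact: (gd_interval diffY).
  apply: (@measurable_comp _ _ _ _ _ _ I
    (fun z => Py z [set w' | C (Y w')]) _ (fun w => ev (Y w) t)) => //.
  + by move=> _ [w _ <-]; exact: (csm_state_space csm).
  + exact: (csm_kernel csm).
  + apply: measurable_funTS.
    exact: (measurableT_comp (@measurable_ev _ setT t _) diffusion_measurable).
- move=> w [/= w0 wt]; rewrite (le_trans _ (Bp (ev (Y w) t) _ _)) ?BE//.
    exact: (csm_state_space csm).
  by apply: inside_before_exit; rewrite ?w0.
Qed.

End path_law.

(** * Exit times are almost surely finite *)

Section path_shifts.
Context {R : realType}.
Implicit Types (f : cpath R) (a b s t u x z : R).

Lemma hit_shift x s u f : 0 <= s -> hit x u (shift_path s f) -> hit x (s + u) f.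
Proof.
move=> s0 [v /andP[v0 vu]]; rewrite ev_shift// => fx.
by exists (s + v); rewrite // addr_ge0//= lerD2l.
Qed.

Lemma exit_shift_path a b s u f : 0 <= s -> 0 <= u ->
  ((s + u)%:E < exit a b f)%E -> (u%:E < exit a b (shift_path s f))%E.
Proof.
move=> s0 u0; rewrite /exit !lt_min !ltNge => /andP[/negP ha /negP hb].
apply/andP; split; apply/negP => /(hitting_time_le _ _ u0)/(hit_shift s0) h.
  by apply: ha; apply/hitting_time_le => //; rewrite addr_ge0.
by apply: hb; apply/hitting_time_le => //; rewrite addr_ge0.
Qed.

Lemma hit_intermediate c x z t f : ev f 0 = c ->
  (c <= z <= x) || (x <= z <= c) -> hit x t f -> hit z t f.
Proof.
move=> f0 czx [s /andP[s0 st] fs].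
have cf : {within `[0, s], continuous (ev f)}.
  by apply: continuous_subspaceT; exact: ev_continuous.
have [|v] := IVT s0 cf (_ : _ <= z <= _).
  by rewrite f0 fs ge_min le_max; case/orP: czx => /andP[-> ->]; rewrite ?orbT.
rewrite in_itv /= => /andP[v0 vs] fv; exists v => //.
by rewrite v0 (le_trans vs).
Qed.

Lemma exit_diag z f : exit z z f = hitting_time z%:E f.
Proof. by rewrite /exit /hitting_time2 minxx. Qed.

Lemma exits_up_diag z f : exits_up z z f.
Proof. exact: lexx. Qed.

Lemma hit_after c x z t f : ev f 0 = c -> 0 <= t ->
  (c <= z <= x) || (x <= z <= c) -> hit x t f ->
  (hitting_time z%:E f < +oo)%E /\
  hit x t (shift_path (fine (hitting_time z%:E f)) f).
Proof.
move=> f0 t0 czx xt.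
have hz : (hitting_time z%:E f <= t%:E)%E.
  by apply/hitting_time_le => //; exact: (hit_intermediate f0 czx).
have hoo : (hitting_time z%:E f < +oo)%E by rewrite (le_lt_trans hz) ?ltry.
split=> //; have hf := hitting_time_fin hoo.
set s := fine _; have s0 : 0 <= s by rewrite fine_ge0// hitting_time_ge0.
have [u /andP[u0 ut] fu] := xt.
have su : s <= u.
  rewrite -lee_fin fineK//; apply/hitting_time_le => //.
  by apply: (hit_intermediate f0 czx); exists u; rewrite ?u0 ?lexx.
exists (u - s); last by rewrite ev_shift ?subr_ge0// addrC subrK.
by rewrite subr_ge0 su/= lerBlDr (le_trans ut)// lerDl.
Qed.

End path_shifts.

Section exit_laws.
Context {R : realType} {I : set R} {l r : \bar R}.
Context {d : measure_display} {Omega : measurableType d}.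
Context {Ft : time R -> set_system Omega} {Py : R -> probability Omega R}.
Context {Y : Omega -> cpath R} {m : {measure set (measurableTypeR R) -> \bar R}}.
Hypothesis diffY : general_diffusion I l r Py Ft Y m.
Implicit Types (a b c x z s t : R).
Local Notation Q := (path_law diffY).

Lemma measurable_shifted (s : path_space R -> R) (B : set (path_space R)) :
  measurable_fun setT s -> measurable B ->
  measurable ([set f | B (shift_path (s f) f)] : set (path_space R)).
Proof.
move=> ms mB; rewrite -[X in measurable X]setTI.
exact: (measurable_shift_random (@measurable_id _ _ _) ms).
Qed.

Lemma measurable_hitting_le x (t : \bar R) :
  measurable ([set f | hitting_time x%:E f <= t]%E : set (path_space R)).
Proof.
rewrite -[X in measurable X]setTI.
by apply: (@emeasurable_fun_infty_c _ _ R setT) => //; exact: measurable_hitting_time.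
Qed.

Lemma measurable_hitting_fin x :
  measurable ([set f | hitting_time x%:E f < +oo]%E : set (path_space R)).
Proof.
rewrite -[X in measurable X]setTI.
by apply: (@emeasurable_fun_infty_o _ _ R setT) => //; exact: measurable_hitting_time.
Qed.

Lemma exit_event_diag z : exit_event z z setT true =
  [set f : path_space R | hitting_time z%:E f < +oo]%E.
Proof.
apply/seteqP; split => f /=; rewrite /exit_event /= exit_diag; first by case.
by move=> hz; split => //; exact: exits_up_diag.
Qed.

(** A single hitting time is the exit time of a degenerate interval. *)
Lemma strong_markov_hitting c z (B : set (path_space R)) : I c -> measurable B ->
  Q c ([set f | hitting_time z%:E f < +oo]%E `&`
       [set f | B (shift_path (fine (hitting_time z%:E f)) f)]) =
  (Q c [set f | hitting_time z%:E f < +oo]%E * Q z B)%E.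
Proof.
move=> Ic mB.
have := strong_markov_exit diffY z z true Ic measurableT mB.
rewrite exit_event_diag => <-; congr (Q c (_ `&` _)).
by apply/seteqP; split => f /=; rewrite exit_diag.
Qed.

(** On its way from c to x the path passes through z, and it has at most the same
time left from there. *)
Lemma hitting_le_between c x z t : I c -> 0 <= t ->
  (c <= z <= x) || (x <= z <= c) ->
  (Q c [set f | hitting_time x%:E f <= t%:E] <=
   Q z [set f | hitting_time x%:E f <= t%:E])%E.
Proof.
move=> Ic t0 czx; set B := [set f | (hitting_time x%:E f <= t%:E)%E].
have mB : measurable (B : set (path_space R)) by exact: measurable_hitting_le.
rewrite -(probability_setI1 (measurable_ev_eq 0 c) mB (path_law_start diffY Ic)).
apply: (@le_trans _ _ (Q c [set f | hitting_time z%:E f < +oo]%E * Q z B)%E);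
  last first.
  rewrite -[leRHS]mul1e lee_wpmul2r//.
  by apply: probability_le1; exact: measurable_hitting_fin.
rewrite -strong_markov_hitting//; apply: le_measure; rewrite ?inE.
- by apply: measurableI => //; exact: measurable_ev_eq.
- apply: measurableI; first exact: measurable_hitting_fin.
  apply: measurable_shifted => //.
  by apply: measurableT_comp => //; exact: measurable_hitting_time.
- move=> f [/= f0 /(hitting_time_le _ _ t0) fx].
  have [h1 h2] := hit_after f0 t0 czx fx; split => //.
  exact/hitting_time_le.
Qed.

Lemma hitting_positive c x : interior I c -> I x ->
  exists n : nat, exists2 q : R, 0 < q &
    (q%:E <= Q c [set f | hitting_time x%:E f <= n%:R%:E])%E.
Proof.
move=> Ic Ix.
pose E n : set (path_space R) := [set f | hitting_time x%:E f <= n%:R%:E]%E.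
have mE n : measurable (E n) by exact: measurable_hitting_le.
have [n qn] : exists n, (0 < Q c (E n))%E.
  apply: contrapT => nE.
  have : (Q c \o E) @ \oo --> Q c (\bigcup_n E n).
    apply: nondecreasing_cvg_mu => //; first exact: bigcup_measurable.
    move=> i j ij; apply/subsetPset => f /= /le_trans; apply.
    by rewrite lee_fin ler_nat.
  have -> : Q c \o E = cst 0%E.
    apply/funext => n /=; apply/eqP; rewrite eq_le measure_ge0 andbT leNgt.
    by apply/negP => ?; apply: nE; exists n.
  move=> /cvge_to_le/(_ (nearW _ (fun=> lexx 0%E))) E0.
  have := gd_regular diffY Ic Ix.
  suff -> : Py c [set w | hitting_time x%:E (Y w) < +oo]%E =
      Q c (\bigcup_n E n) by rewrite ltNge E0.
  rewrite path_lawE; congr (Py c _); apply/seteqP; split => w /=.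
    move=> hoo; have hf := hitting_time_fin hoo.
    exists (Num.truncn (fine (hitting_time x%:E (Y w)))).+1 => //=.
    by rewrite /E /= -(fineK hf) lee_fin ltW// truncnS_gt.
  by move=> [n _]; rewrite /E /= => /le_lt_trans; apply; rewrite ltry.
exists n, (fine (Q c (E n))); rewrite ?fineK ?fin_num_measure//.
by rewrite fine_gt0// qn /= (le_lt_trans (probability_le1 _ (mE n))) ?ltry.
Qed.

(** The Markov property at the times s, 2 s, ..., n s. *)
Lemma exit_tail a b s p : 0 <= s -> 0 <= p ->
  (forall z, I z -> a < z < b -> (Q z [set f | s%:E < exit a b f]%E <= p%:E)%E) ->
  forall n z, I z -> a < z < b ->
  (Q z [set f | (n%:R * s)%:E < exit a b f]%E <= (p ^+ n)%:E)%E.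
Proof.
move=> s0 p0 Qp; elim=> [|n ih] z Iz azb.
  by apply: probability_le1; exact: measurable_exit_gt.
apply: (@le_trans _ _ (Q z ([set f | s%:E < exit a b f]%E `&`
    [set f | ((n%:R * s)%:E < exit a b (shift_path s f))%E]))).
  apply: le_measure; rewrite ?inE.
  - exact: measurable_exit_gt.
  - apply: measurableI; first exact: measurable_exit_gt.
    apply: (@measurable_shifted (fun=> s)
      [set g | ((n%:R * s)%:E < exit a b g)%E]) => //.
    exact: measurable_exit_gt.
  - move=> f /= fs; split; last first.
      apply: exit_shift_path => //; first by rewrite mulr_ge0.
      by rewrite -[X in X + _]mul1r -mulrDl nat1r.
    by apply: le_lt_trans fs; rewrite lee_fin ler_peMl// ler1n.
have /le_trans := markov_before_exit Iz azb s0 (exprn_ge0 n p0)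
  (measurable_exit_gt a b (n%:R * s)%:E) ih.
by apply; rewrite exprSr EFinM lee_wpmul2l ?lee_fin ?exprn_ge0// Qp.
Qed.

(** The probability of leaving (a, b) before some time N is bounded below
uniformly over the starting points: by [hitting_le_between] a start to the left
of z reaches a at least as fast as z does, and a start to the right of z reaches
b at least as fast. By [exit_tail] staying forever has probability 0. Regularity
is what makes this work when a or b is a boundary point, near which the speed
measure may be infinite. *)
Lemma exit_finite a b z : I a -> I b -> a < z < b ->
  Q z [set f | exit a b f < +oo]%E = 1%E.
Proof.
move=> Ia Ib azb.
have iI := gd_interval diffY.
have IIv v : a < v < b -> I v.
  by move=> /andP[av vb]; apply: (iI a b) => //; rewrite !ltW.
have Ic : interior I z.
  have : `]a, b[%classic `<=` I by move=> v; rewrite /= in_itv; exact: IIv.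
  by rewrite open_subsetE//; apply; rewrite /= in_itv.
have [n [q q0 qn]] := hitting_positive Ic Ia.
have [n' [q' q'0 q'n]] := hitting_positive Ic Ib.
pose N := maxn n n'; pose p := 1 - Num.min q q'.
have le_ht x k k' : (k <= k')%N -> forall u,
  (Q u [set f | hitting_time x%:E f <= k%:R%:E] <=
   Q u [set f | hitting_time x%:E f <= k'%:R%:E])%E.
  move=> kk' u; apply: le_measure; rewrite ?inE; try exact: measurable_hitting_le.
  by move=> f /= /le_trans; apply; rewrite lee_fin ler_nat.
have p0 : 0 <= p.
  rewrite subr_ge0 ge_min -lee_fin (le_trans qn)//.
  by apply: probability_le1; exact: measurable_hitting_le.
have p1 : p < 1 by rewrite ltrBlDr ltrDl lt_min q0 q'0.
have tail1 v x k q'' : x = a \/ x = b -> (q''%:E <=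
    Q v [set f | hitting_time x%:E f <= k%:R%:E])%E ->
    (k <= N)%N -> Num.min q q' <= q'' ->
    (Q v [set f | N%:R%:E < exit a b f] <= p%:E)%E.
  move=> xab q''x kN qq''.
  apply: (@le_trans _ _ (Q v (~` [set f | hitting_time x%:E f <= k%:R%:E]%E))).
    apply: le_measure; rewrite ?inE; first exact: measurable_exit_gt.
      by apply: measurableC; exact: measurable_hitting_le.
    move=> f /= Nf; apply/negP; rewrite -ltNge.
    apply: (@le_lt_trans _ _ N%:R%:E); first by rewrite lee_fin ler_nat.
    apply: (lt_le_trans Nf); rewrite ge_min.
    by case: xab => ->; rewrite lexx ?orbT.
  rewrite probability_setC; last exact: measurable_hitting_le.
  by rewrite EFinB leeB// (le_trans _ q''x)// lee_fin.
have tail2 v : I v -> a < v < b -> (Q v [set f | N%:R%:E < exit a b f] <= p%:E)%E.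
  move=> Iv /andP[av vb]; have /orP[vz|zv] := le_total v z.
    apply: (tail1 v a n q) => //; first by left.
    - apply: (le_trans qn); apply: hitting_le_between => //.
      + exact: interior_subset.
      + by rewrite vz (ltW av) orbT.
    - exact: leq_maxl.
    - by rewrite ge_min lexx.
  apply: (tail1 v b n' q') => //; first by right.
  - apply: (le_trans q'n); apply: hitting_le_between => //.
    + exact: interior_subset.
    + by rewrite zv (ltW vb).
  - exact: leq_maxr.
  - by rewrite ge_min lexx orbT.
have mfin : measurable ([set f | exit a b f < +oo]%E : set (path_space R)).
  rewrite -[X in measurable X]setTI.
  by apply: (@emeasurable_fun_infty_o _ _ R setT) => //; exact: measurable_exit.
suff oo0 : Q z (~` [set f | exit a b f < +oo]%E) = 0%E.
  by have := probability_setC (Q z) (measurableC mfin); rewrite setCK oo0 sube0.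
apply/eqP; rewrite -measure_le0.
have : ((p ^+ k)%:E @[k --> \oo] --> 0%:E)%E.
  apply/fine_cvgP; split; first by apply: nearW.
  by apply: cvg_expr; rewrite ger0_norm.
move=> /cvge_to_ge; apply; apply: nearW => k.
apply: le_trans (exit_tail (ler0n _ N) p0 tail2 k (interior_subset Ic) azb).
apply: le_measure; rewrite ?inE; first exact: measurableC.
  exact: measurable_exit_gt.
by move=> f /=; case: (exit a b f) (exit_ge0 a b f) => //= [x _|_ _]; rewrite ltry.
Qed.

End exit_laws.

(** * Integrals over an independent remainder *)

Section restricted_law.
Context {R : realType} d1 d2 (X : measurableType d1) (W : measurableType d2).
Variables (mu : {finite_measure set X -> \bar R}) (E : set X).
Hypothesis mE : measurable E.
Variable s : {mfun X >-> W}.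

Definition restricted_law : set W -> \bar R := pushforward (mrestr mu mE) s.

Let restricted_law0 : restricted_law set0 = 0%E.
Proof. exact: measure0. Qed.

Let restricted_law_ge0 A : (0 <= restricted_law A)%E.
Proof. exact: measure_ge0. Qed.

Let restricted_law_sigma_additive : semi_sigma_additive restricted_law.
Proof. exact: measure_semi_sigma_additive. Qed.

HB.instance Definition _ := isMeasure.Build _ _ _ restricted_law
  restricted_law0 restricted_law_ge0 restricted_law_sigma_additive.

Let restricted_law_finite : fin_num_fun restricted_law.
Proof.
move=> A mA; rewrite /restricted_law /pushforward /mrestr fin_num_measure//.
by apply: measurableI => //; exact: measurable_funPTI.
Qed.

HB.instance Definition _ := @Measure_isFinite.Build _ _ _ restricted_law
  restricted_law_finite.

Local Open Scope ereal_scope.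

Lemma ge0_integral_restricted_law (f : W -> \bar R) :
  measurable_fun setT f -> (forall x, 0 <= f x) ->
  \int[restricted_law]_w f w = \int[mu]_(x in E) f (s x).
Proof.
move=> mf f0; rewrite ge0_integral_pushforward//.
have mfs : measurable_fun setT (f \o s) by exact: measurableT_comp.
have E0 : mrestr mu mE (~` E) = 0.
  by rewrite /mrestr (_ : _ `&` _ = set0) ?measure0//; apply/seteqP; split => // x [].
rewrite (ge0_negligible_integral (measurableC mE) measurableT mfs _ E0); last first.
  by move=> x _; exact: f0.
rewrite setTD setCK; apply: eq_measure_integral => A mA AE.
by rewrite /= /mrestr; congr (mu _); apply/setIidPl.
Qed.

End restricted_law.

Section independent_rest.
Context {R : realType} d1 d2 (X : measurableType d1) (W : measurableType d2).
Local Open Scope ereal_scope.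

(** On E the pair (s, g) has a product law with second factor nu; Tonelli. *)
Lemma ge0_integral_independent (mu : probability X R) (nu : probability W R)
    (E : set X) (s : X -> R) (g : X -> W) (G : R * W -> \bar R) :
  measurable E -> measurable_fun setT s -> measurable_fun setT g ->
  (forall A B, measurable A -> measurable B ->
     mu (E `&` (s @^-1` A `&` g @^-1` B)) = mu (E `&` s @^-1` A) * nu B) ->
  measurable_fun setT G -> (forall z, 0 <= G z) ->
  \int[mu]_(x in E) G (s x, g x) =
  \int[mu]_(x in E) \int[nu]_w G (s x, w).
Proof.
move=> mE ms mg indep mG G0.
have msg : measurable_fun setT (fun x => (s x, g x)) by exact: measurable_fun_pair.
pose s' : {mfun X >-> R} := mfun_Sub (mem_set ms).
pose sg : {mfun X >-> (R * W)%type} := mfun_Sub (mem_set msg).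
transitivity (\int[restricted_law mu mE sg]_z G z).
  by rewrite ge0_integral_restricted_law.
transitivity (\int[restricted_law mu mE s' \x nu]_z G z).
  apply: eq_measure_integral => A mA _; apply/esym/product_measure_unique => //.
  move=> B C mB mC; rewrite /restricted_law /pushforward /mrestr.
  transitivity (mu (E `&` (s @^-1` B `&` g @^-1` C))).
    by congr (mu _); rewrite setIC.
  by rewrite indep//; congr (mu _ * _); rewrite setIC.
rewrite fubini_tonelli1//= ge0_integral_restricted_law//.
- exact: measurable_fun_fubini_tonelli_F.
- by move=> x; exact: integral_ge0.
Qed.

End independent_rest.

(** * One step of the embedding *)

Section step.
Context {R : realType}.
Implicit Types (f : cpath R) (y al : R).

(** One step of length al from y ends at y + al or at y - al. The centre is the
parameter y rather than the starting point of f: the embedded chain then has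
deterministic possible positions, and a_h is only evaluated at those. *)
Definition step_end y al f : R :=
  if exits_up (y - al) (y + al) f then y + al else y - al.

Definition step_time y al f : R := fine (exit (y - al) (y + al) f).

Definition step_rest y al f : path_space R := shift_path (step_time y al f) f.

Lemma step_time_ge0 y al f : 0 <= step_time y al f.
Proof. by rewrite fine_ge0// exit_ge0. Qed.

Lemma measurable_step_time y al :
  measurable_fun setT (step_time y al : path_space R -> R).
Proof. by apply: measurableT_comp => //; exact: measurable_exit. Qed.

Lemma measurable_step_rest y al :
  measurable_fun setT (step_rest y al : path_space R -> path_space R).
Proof.
exact: (measurable_shift_random (@measurable_id _ _ _)
  (measurable_step_time y al)).
Qed.

Lemma measurable_step_end_set y al (B : R -> path_space R -> Prop) :
  (forall z, measurable [set f | B z f]) ->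
  measurable [set f : path_space R | B (step_end y al f) f].
Proof.
move=> mB.
rewrite (_ : mkset _ =
  (exits_up (y - al) (y + al) @^-1` [set true] `&` [set f | B (y + al) f]) `|`
  (exits_up (y - al) (y + al) @^-1` [set false] `&` [set f | B (y - al) f])).
  apply: measurableU; apply: measurableI; try exact: mB;
  by rewrite -[X in measurable X]setTI; exact: measurable_exits_up.
apply/seteqP; split => f /=; rewrite /step_end; case: ifP => //.
- by move=> _ ?; left.
- by move=> _ ?; right.
- by move=> _ [] [].
- by move=> _ [] [].
Qed.

End step.

Section one_step.
Context {R : realType} {I : set R} {l r : \bar R}.
Context {d : measure_display} {Omega : measurableType d}.
Context {Ft : time R -> set_system Omega} {Py : R -> probability Omega R}.
Context {Y : Omega -> cpath R} {m : {measure set (measurableTypeR R) -> \bar R}}.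
Hypothesis diffY : general_diffusion I l r Py Ft Y m.
Implicit Types (a b c x y z s t al : R).
Local Notation Q := (path_law diffY).

(** Once an exit takes place through one of two distinct ends, [exits_up] decides
between them by the order of the hitting times, as natural scale does. *)
Lemma exit_event_up a b : a != b -> exit_event a b setT true =
  [set f : path_space R | hitting_time b%:E f < hitting_time a%:E f]%E.
Proof.
move=> ab; apply/seteqP; split => f /=; rewrite /exit_event /= /exits_up.
  move=> [eoo _ hba]; rewrite lt_neqAle hba andbT; apply/eqP => hE.
  move: eoo; rewrite /exit /hitting_time2 -hE minxx => hoo.
  have := ev_hitting_time hoo; rewrite hE ev_hitting_time -?hE// => /eqP.
  by rewrite (negPf ab).
move=> hba; split => //; last by rewrite ltW.
by rewrite /exit gt_min orbC; apply/orP; left; apply: (lt_le_trans hba); rewrite leey.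
Qed.

Lemma measurable_exit_fin a b :
  measurable ([set f | exit a b f < +oo]%E : set (path_space R)).
Proof.
rewrite -[X in measurable X]setTI.
by apply: (@emeasurable_fun_infty_o _ _ R setT) => //; exact: measurable_exit.
Qed.

Lemma exit_event_split a b : [set f : path_space R | exit a b f < +oo]%E =
  exit_event a b setT true `|` exit_event a b setT false.
Proof.
apply/seteqP; split => f /=; last by move=> [] [].
by move=> eoo; case: (boolP (exits_up a b f)) => [h|/negbTE h]; [left|right].
Qed.

Lemma exit_event_disjoint a b S :
  exit_event a b S true `&` exit_event a b S false = set0.
Proof.
by apply/seteqP; split => // f [[_ _ h] [_ _]]; rewrite h.
Qed.

(** The midpoint case of natural scale; the other end has the complementary
probability because the exit time is finite. *)
Lemma exit_event_half y al e : 0 < al -> I (y - al) -> I (y + al) ->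
  Q y (exit_event (y - al) (y + al) setT e) = (2^-1)%:E.
Proof.
move=> al0 Ia Ib.
have ayb : y - al < y < y + al by lra.
have up : Q y (exit_event (y - al) (y + al) setT true) = (2^-1)%:E.
  rewrite exit_event_up; last by rewrite lt_eqF//; lra.
  rewrite path_lawE -[LHS]/(Py y [set w | (hitting_time (y + al)%:E (Y w) <
    hitting_time (y - al)%:E (Y w))%E]).
  rewrite (gd_natural_scale diffY Ia Ib ayb); congr EFin.
  have al20 : y + al - (y - al) != 0 by rewrite gt_eqF//; lra.
  apply: (mulIf al20); rewrite divfK//; lra.
case: e => //.
have h : ((2^-1)%:E + Q y (exit_event (y - al) (y + al) setT false) = 1)%E.
  rewrite -up -measureU ?exit_event_disjoint -?exit_event_split//;
    try exact: measurable_exit_event.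
  exact: exit_finite.
rewrite -[LHS](@addeK _ (2^-1)%:E)// [X in (X - _)%E]addeC h -EFinB.
congr EFin; lra.
Qed.

Lemma strong_markov_step y al e (A : set R) (B : set (path_space R)) :
  I y -> measurable A -> measurable B ->
  Q y (exit_event (y - al) (y + al) setT e `&`
        (step_time y al @^-1` A `&` step_rest y al @^-1` B)) =
  (Q y (exit_event (y - al)%R (y + al)%R setT e `&` step_time y al @^-1` A) *
   Q (if e then y + al else y - al)%R B)%E.
Proof.
move=> Iy mA mB.
have mS : measurable (fine @^-1` A : set (\bar R)).
  by rewrite -[X in measurable X]setTI; exact: fine_measurable.
have SE : exit_event (y - al) (y + al) setT e `&` step_time y al @^-1` A =
  exit_event (y - al) (y + al) (fine @^-1` A) e.
  by apply/seteqP; split => f /=; rewrite /exit_event /=; [case=> -[]|case].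
by rewrite setIA SE; exact: strong_markov_exit.
Qed.

(** The two ends are equally likely, and from there the rest of the path starts
afresh. A step of length 0 takes no time and both terms on the right agree. *)
Lemma one_step y al (B : R -> set (path_space R)) :
  I y -> 0 <= al -> I (y - al) -> I (y + al) -> (forall z, measurable (B z)) ->
  Q y [set f | B (step_end y al f) (step_rest y al f)] =
  ((2^-1)%:E * Q (y + al)%R (B (y + al)%R) +
   (2^-1)%:E * Q (y - al)%R (B (y - al)%R))%E.
Proof.
move=> Iy al0 Ia Ib mB.
have mrest z : measurable (step_rest y al @^-1` B z : set (path_space R)).
  by rewrite -[X in measurable X]setTI; exact: measurable_step_rest.
have mBs : measurable
    ([set f | B (step_end y al f) (step_rest y al f)] : set (path_space R)).
  by apply: (@measurable_step_end_set R y al (fun z f => B z (step_rest y al f))) => z; exact: mrest.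
move: al0; rewrite le_eqVlt => /orP[/eqP al0|al0].
  rewrite -al0 addr0 subr0 -ge0_muleDl ?lee_fin ?invr_ge0// -EFinD.
  rewrite (_ : 2^-1 + 2^-1 = 1); last lra.
  rewrite mul1e -(probability_setI1 (measurable_ev_eq 0 y) _ (path_law_start diffY Iy)); last by rewrite al0.
  rewrite -[RHS](probability_setI1 (measurable_ev_eq 0 y) _ (path_law_start diffY Iy))//.
  congr (Q y _).
  have ends f : ev f 0 = y -> step_end y 0 f = y /\ step_rest y 0 f = f.
    move=> f0; rewrite /step_end addr0 subr0 if_same; split => //.
    rewrite /step_rest /step_time subr0 addr0 exit_diag.
    suff -> : hitting_time y%:E f = 0%:E by rewrite shift_path0.
    apply/eqP; rewrite eq_le hitting_time_ge0 andbT; apply/hitting_time_le => //.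
    by exists 0; rewrite ?lexx.
  by apply/seteqP; split => f [/= f0]; have [-> ->] := ends _ f0.
have ayb : y - al < y < y + al by lra.
rewrite -(probability_setI1 (measurable_exit_fin (y - al) (y + al)) mBs
  (exit_finite diffY Ia Ib ayb)).
rewrite exit_event_split setIUl measureU; last 3 first.
- apply: measurableI => //; exact: measurable_exit_event.
- apply: measurableI => //; exact: measurable_exit_event.
- by rewrite setIACA exit_event_disjoint set0I.
have half e : Q y (exit_event (y - al) (y + al) setT e `&`
    [set f | B (step_end y al f) (step_rest y al f)]) =
  ((2^-1)%:E * Q (if e then y + al else y - al)%R
     (B (if e then y + al else y - al)%R))%E.
  have := strong_markov_step al e Iy measurableT (mB (if e then y + al else y - al)).
  rewrite preimage_setT setTI setIT exit_event_half// => <-; congr (Q y _).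
  by apply/seteqP; split => f [[/= ? _ eE]]; rewrite /step_end eE.
by congr (_ + _)%E; [exact: (half true)|exact: (half false)].
Qed.

Local Open Scope ereal_scope.

(** The version of [one_step] that keeps the duration of the step. Given the end z,
the duration is independent of the rest, so the rest can be integrated first,
with the duration as a parameter. *)
Lemma one_step_integral y al (G : R -> R * path_space R -> \bar R)
    (u : R -> \bar R) :
  I y -> (0 < al)%R -> I (y - al)%R -> I (y + al)%R ->
  (forall z, measurable_fun setT (G z)) -> (forall z sf, 0 <= G z sf) ->
  measurable_fun setT u -> (forall s, 0 <= u s) ->
  (forall s z, I z -> \int[Q z]_f G z (s, f) <= u s) ->
  \int[Q y]_f G (step_end y al f) (step_time y al f, step_rest y al f) <=
  \int[Q y]_f u (step_time y al f).
Proof.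
move=> Iy al0 Ia Ib mG G0 mu u0 Gu.
have ayb : (y - al < y < y + al)%R by lra.
have fin0 : Q y (~` [set f | exit (y - al)%R (y + al)%R f < +oo]) = 0.
  rewrite probability_setC; last exact: measurable_exit_fin.
  by rewrite (exit_finite diffY Ia Ib ayb) subee.
have split_int (g : path_space R -> \bar R) : measurable_fun setT g ->
    (forall f, 0 <= g f) -> \int[Q y]_f g f =
    \int[Q y]_(f in exit_event (y - al)%R (y + al)%R setT true) g f +
    \int[Q y]_(f in exit_event (y - al)%R (y + al)%R setT false) g f.
  move=> mg g0.
  rewrite (ge0_negligible_integral (measurableC (measurable_exit_fin _ _))
    measurableT mg _ fin0)// setTD setCK exit_event_split.
  rewrite ge0_integral_setU//; try exact: measurable_exit_event.
    exact: measurable_funTS.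
  by apply/disj_setPS; rewrite exit_event_disjoint.
have mTR : measurable_fun setT (fun f : path_space R =>
    (step_time y al f, step_rest y al f)).
  apply: measurable_fun_pair; first exact: measurable_step_time.
  exact: measurable_step_rest.
have mut : measurable_fun setT (u \o (step_time y al : path_space R -> R)).
  by apply: measurableT_comp => //; exact: measurable_step_time.
have mGG : measurable_fun setT (fun f : path_space R =>
    G (step_end y al f) (step_time y al f, step_rest y al f)).
  rewrite (_ : (fun _ => _) = fun f => if exits_up (y - al)%R (y + al)%R f
    then G (y + al)%R (step_time y al f, step_rest y al f)
    else G (y - al)%R (step_time y al f, step_rest y al f)); last first.
    by apply/funext => f; rewrite /step_end; case: ifP.
  by apply: measurable_fun_ifT; [exact: measurable_exits_up|
    exact: measurableT_comp|exact: measurableT_comp].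
rewrite split_int// (split_int (u \o step_time y al))//; last first.
  by move=> f; exact: u0.
have half e :
  \int[Q y]_(f in exit_event (y - al)%R (y + al)%R setT e)
    G (step_end y al f) (step_time y al f, step_rest y al f) <=
  \int[Q y]_(f in exit_event (y - al)%R (y + al)%R setT e) u (step_time y al f).
  have mE : measurable (exit_event (y - al)%R (y + al)%R setT e).
    exact: measurable_exit_event.
  set z := (if e then y + al else y - al)%R.
  have Iz : I z by rewrite /z; case: (e).
  rewrite (eq_integral (fun f : path_space R => G z (step_time y al f, step_rest y al f))); last first.
    by move=> f; rewrite inE => -[_ _ eE]; rewrite /step_end eE.
  rewrite (@ge0_integral_independent _ _ _ _ _ (Q y) (Q z))//.
  - apply: ge0_le_integral => //.
    + by move=> f _; exact: integral_ge0.
    + apply: measurable_funTS; apply: (measurableT_comp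
        (f := fun s => \int[Q z]_w G z (s, w)) _ (measurable_step_time y al)).
      exact: measurable_fun_fubini_tonelli_F.
    + exact: measurable_funTS.
    + by move=> f _; exact: Gu.
  - exact: measurable_step_time.
  - exact: measurable_step_rest.
  - by move=> A B mA mB; exact: strong_markov_step.
by apply: leeD; exact: half.
Qed.

End one_step.

(** * Moments of the duration of a step *)

Section second_moment.
Context {R : realType} d (X : measurableType d) (P : probability X R).
Local Open Scope ereal_scope.

Lemma odd_le_pow4 n : (n.*2 + 3 <= 3 * 4 ^ n)%N.
Proof.
elim: n => // n ih; rewrite expnS doubleS.
by have : (1 <= 4 ^ n)%N; [rewrite expn_gt0|lia].
Qed.

Lemma sum_odd n : (\sum_(0 <= k < n) (k.*2 + 3)%:R = n.+1%:R ^+ 2 - 1 :> R)%R.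
Proof.
elim: n => [|n ih]; first by rewrite big_nil expr1n subrr.
rewrite big_nat_recr//= ih natrD -muln2 natrM -!natr1; ring.
Qed.

(** If k c <= t < (k+1) c then t^2 is at most (k+1)^2 c^2, which is c^2 plus the
sum of the c^2 (2 n + 3) over n < k, and n c < t for these n. Integrate term by
term: since 2 n + 3 <= 3 * 4^n, the tail bound 8^-n leaves a geometric series of
ratio 1/2 and sum 6 c^2. *)
Lemma second_moment_geometric_tail (t : X -> R) (c : R) :
  (0 < c)%R -> measurable_fun setT t -> (forall x, 0 <= t x)%R ->
  (forall n : nat, P [set x | n%:R * c < t x]%R <= ((8^-1) ^+ n)%:E) ->
  \int[P]_x ((t x) ^+ 2)%:E <= (7 * c ^+ 2)%:E.
Proof.
move=> c0 mt t0 tailt.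
pose A n := [set x | (n%:R * c < t x)%R].
have mA n : measurable (A n).
  rewrite (_ : A n = t @^-1` [set` `]n%:R * c, +oo[%R]); last first.
    by apply/seteqP; split => x /=; rewrite in_itv /= andbT.
  by rewrite -[X in measurable X]setTI; apply: mt => //; exact: measurable_itv.
pose u n : R := (c ^+ 2 * (n.*2 + 3)%:R)%R.
have u0 n : (0 <= u n)%R by rewrite mulr_ge0// sqr_ge0.
have c20 : (0 <= c ^+ 2)%R by rewrite sqr_ge0.
pose s x := \sum_(n <oo) ((u n)%:E * (\1_(A n) x)%:E).
have term0 n x : 0 <= (u n)%:E * (\1_(A n) x)%:E by rewrite mule_ge0// lee_fin.
have mterm n : measurable_fun setT (fun x => (u n)%:E * (\1_(A n) x)%:E).
  by apply: measurable_funeM; apply/measurable_EFinP; exact: measurable_indic.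
have ts x : ((t x) ^+ 2)%:E <= (c ^+ 2)%:E + s x.
  have tc0 : (0 <= t x / c)%R by rewrite divr_ge0// ltW.
  have /andP[k1 k2] := truncn_itv tc0; set k := Num.truncn _ in k1 k2.
  have := @nneseries_lim_ge _ (fun n => (u n)%:E * (\1_(A n) x)%:E) xpredT 0 k
    (fun n _ _ => term0 n x).
  move=> h; apply: le_trans (leeD (lexx _) h).
  rewrite (eq_big_nat _ _ (F2 := fun n => (u n)%:E)); last first.
    move=> n /andP[_ nk]; rewrite indicE mem_set ?mule1// /A /=.
    rewrite -ltr_pdivlMr// (lt_le_trans _ k1)// ltr_nat//.
  rewrite sumEFin -EFinD lee_fin /u -mulr_sumr sum_odd.
  rewrite [leRHS](_ : _ = (c * k.+1%:R) ^+ 2)%R; last ring.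
  rewrite ler_sqr ?nnegrE ?mulr_ge0 ?t0 ?(ltW c0)//.
  by rewrite mulrC -ler_pdivrMr// ltW.
have s0 x : 0 <= s x by apply: nneseries_ge0.
have ms : measurable_fun setT s.
  by apply: ge0_emeasurable_sum => //.
apply: (@le_trans _ _ (\int[P]_x ((c ^+ 2)%:E + s x))).
  apply: ge0_le_integral => //.
  - by move=> x _; rewrite lee_fin sqr_ge0.
  - by apply/measurable_EFinP; exact: measurable_funX.
  - exact: emeasurable_funD.
rewrite ge0_integralD// integral_cst// [X in _ * X + _]probability_setT mule1.
rewrite integral_nneseries//.
apply: (@le_trans _ _ ((c ^+ 2)%:E + \sum_(n <oo) ((6 * c ^+ 2) / (2 ^ (n + 1))%:R)%:E)).
  rewrite leeD2l//; apply: lee_nneseries => n.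
    by move=> _ _; exact: integral_ge0.
  move=> _; rewrite ge0_integralZl//; last 2 first.
  - by apply/measurable_EFinP; exact: measurable_indic.
  - by rewrite lee_fin.
  rewrite integral_indic// setIT.
  apply: (@le_trans _ _ ((u n)%:E * ((8^-1) ^+ n)%:E)); first
    by apply: lee_wpmul2l; [rewrite lee_fin|exact: tailt].
  rewrite -EFinM lee_fin /u.
  have a0 : (0 < 4 ^+ n :> R)%R by rewrite exprn_gt0.
  have b0 : (0 < 2 ^+ n :> R)%R by rewrite exprn_gt0.
  have -> : (8^-1 ^+ n = (4 ^+ n)^-1 * (2 ^+ n)^-1 :> R)%R.
    by rewrite -!exprVn -exprMn -invfM -natrM.
  rewrite addn1 natrX [(2 ^+ n.+1)%R]exprSr.
  have K : ((n.*2 + 3)%:R <= 3 * 4 ^+ n :> R)%R.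
    by rewrite -natrX -natrM ler_nat; exact: odd_le_pow4.
  rewrite (_ : 6 * c ^+ 2 / (2 ^+ n * 2) =
    c ^+ 2 * (3 * 4 ^+ n) * ((4 ^+ n)^-1 * (2 ^+ n)^-1))%R.
    rewrite ler_wpM2r ?mulr_ge0 ?invr_ge0 ?(ltW a0) ?(ltW b0)//.
    by rewrite ler_wpM2l.
  by field; rewrite !gt_eqF.
rewrite (cvg_lim _ (@cvg_geometric_eseries_half _ _ _))//.
rewrite -EFinD lee_fin expr0 divr1; lra.
Qed.

End second_moment.

Section step_moments.
Context {R : realType} {I : set R} {l r : \bar R}.
Context {d : measure_display} {Omega : measurableType d}.
Context {Ft : time R -> set_system Omega} {Py : R -> probability Omega R}.
Context {Y : Omega -> cpath R} {m : {measure set (measurableTypeR R) -> \bar R}}.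
Hypothesis diffY : general_diffusion I l r Py Ft Y m.
Implicit Types (a b c x y z s t al h : R).
Local Notation Q := (path_law diffY).
Local Open Scope ereal_scope.

(** Twice the mean duration of a step of length al from y, see
[integral_exit_center]. *)
Definition tent_integral y al :=
  \int[m]_(u in `](y - al)%R, (y + al)%R[) (al - `|u - y|)%:E.

Lemma integral_exit a b z : I a -> I b -> (a < b)%R -> (a <= z <= b)%R ->
  \int[Q z]_f exit a b f =
  \int[m]_(u in `]a, b[) ((b - Num.max z u) * (Num.min z u - a) / (b - a))%:E.
Proof.
move=> Ia Ib ab azb; rewrite -(gd_exit_time diffY Ia Ib ab azb).
rewrite ge0_integral_pushforward//.
- exact: measurable_exit.
- by move=> f _; exact: exit_ge0.
Qed.

Lemma measurable_tent y al :
  measurable_fun setT (fun u : measurableTypeR R => (al - `|u - y|)%:E : \bar R).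
Proof.
apply/measurable_EFinP; apply: measurable_funB => //.
by apply: measurableT_comp => //; exact: measurable_funB.
Qed.

Lemma measurable_green a b z :
  measurable_fun setT (fun u : measurableTypeR R =>
    ((b - Num.max z u) * (Num.min z u - a) / (b - a))%:E : \bar R).
Proof.
apply/measurable_EFinP; apply: measurable_funM => //; apply: measurable_funM.
  by apply: measurable_funB => //; exact: measurable_maxr.
by apply: measurable_funB => //; exact: measurable_minr.
Qed.

Lemma integral_exit_center y al : I (y - al)%R -> I (y + al)%R -> (0 < al)%R ->
  \int[Q y]_f exit (y - al)%R (y + al)%R f = (2^-1)%:E * tent_integral y al.
Proof.
move=> Ia Ib al0; rewrite integral_exit//; [|lra|lra].
rewrite -ge0_integralZl//.
- apply: eq_integral => u; rewrite inE /= in_itv /= => /andP[au ub].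
  rewrite -EFinM; congr EFin.
  have al20 : (y + al - (y - al) != 0)%R by rewrite gt_eqF//; lra.
  apply: (mulIf al20); rewrite divfK//.
  have [yu|uy] := leP y u.
    by have -> : (`|u - y| = u - y)%R; [rewrite ger0_norm// subr_ge0|field].
  by have -> : (`|u - y| = y - u)%R;
    [rewrite ltr0_norm ?opprB// subr_lt0|field].
- apply: measurable_funTS; exact: measurable_tent.
- move=> u; rewrite /= in_itv /= => /andP[au ub].
  by rewrite lee_fin subr_ge0 ler_norml; apply/andP; split; lra.
Qed.

(** At u the Green function of (y - al, y + al) is at most al - |u - y| for every
starting point: twice its value for the starting point y. *)
Lemma integral_exit_le y al z : I (y - al)%R -> I (y + al)%R -> (0 < al)%R ->
  (y - al <= z <= y + al)%R ->
  \int[Q z]_f exit (y - al)%R (y + al)%R f <= tent_integral y al.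
Proof.
move=> Ia Ib al0 zal; rewrite integral_exit//; last lra.
apply: ge0_le_integral => //.
- move=> u; rewrite /= in_itv /= => /andP[au ub]; rewrite lee_fin.
  apply: divr_ge0; last lra.
  apply: mulr_ge0; rewrite subr_ge0 ?ge_max ?le_min; apply/andP; split; lra.
- apply: measurable_funTS; exact: measurable_green.
- apply: measurable_funTS; exact: measurable_tent.
- move=> u; rewrite /= in_itv /= => /andP[au ub]; rewrite lee_fin.
  rewrite ler_pdivrMr; last lra.
  have [yu|uy] := leP y u.
    have -> : (`|u - y| = u - y)%R by rewrite ger0_norm// subr_ge0.
    by have [zu|uz] := leP z u; apply: ler_pM; lra.
  have -> : (`|u - y| = y - u)%R by rewrite ltr0_norm ?opprB// subr_lt0.
  by rewrite [leRHS]mulrC; have [zu|uz] := leP z u; apply: ler_pM; lra.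
Qed.

End step_moments.
Arguments tent_integral {R} m y al.

Lemma markov_bound {R : realType} d (X : measurableType d) (P : probability X R)
    (g : X -> \bar R) (c : R) : 0 < c -> measurable_fun setT g ->
  (forall x, 0 <= g x)%E ->
  (c%:E * P [set x | c%:E < g x] <= \int[P]_x g x)%E.
Proof.
move=> c0 mg g0.
have mA : measurable [set x | (c%:E < g x)%E].
  rewrite (_ : mkset _ = ~` [set x | (g x <= c%:E)%E]); last first.
    by apply/seteqP; split => x /=; rewrite ltNge => /negP.
  apply: measurableC; rewrite -[X in measurable X]setTI.
  exact: emeasurable_fun_infty_c.
rewrite -integral_cst//; apply: (@le_trans _ _ (\int[P]_(x in [set x | (c%:E < g x)%E]) g x)%E).
  apply: ge0_le_integral => //.
  - by move=> x _; rewrite lee_fin ltW.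
  - exact: measurable_funTS.
  - by move=> x /= /ltW.
exact: ge0_subset_integral.
Qed.

Section step_square.
Context {R : realType} {I : set R} {l r : \bar R}.
Context {d : measure_display} {Omega : measurableType d}.
Context {Ft : time R -> set_system Omega} {Py : R -> probability Omega R}.
Context {Y : Omega -> cpath R} {m : {measure set (measurableTypeR R) -> \bar R}}.
Hypothesis diffY : general_diffusion I l r Py Ft Y m.
Implicit Types (a b c x y z s t al h e : R).
Local Notation Q := (path_law diffY).
Local Open Scope ereal_scope.

(** The mean exit time is at most 4 h from every starting point, so that the
probability of an exit after 32 h is at most 1/8; [exit_tail] turns this into a
geometric tail on the scale 32 h. *)
Lemma step_second_moment y al h : I (y - al)%R -> I (y + al)%R -> I y ->
  (0 < al)%R -> (0 < h)%R -> tent_integral m y al <= (4 * h)%:E ->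
  \int[Q y]_f ((step_time y al f) ^+ 2)%:E <= (7 * (32 * h) ^+ 2)%:E.
Proof.
move=> Ia Ib Iy al0 h0 tenth.
have h320 : (0 < 32 * h)%R by rewrite mulr_gt0.
apply: second_moment_geometric_tail => //.
- exact: measurable_step_time.
- by move=> f; exact: step_time_ge0.
move=> n.
have tail z : I z -> (y - al < z < y + al)%R ->
    Q z [set f | (32 * h)%:E < exit (y - al)%R (y + al)%R f] <= (8^-1)%:E.
  move=> Iz /andP[az zb].
  rewrite -(@lee_pmul2l _ (32 * h)%:E) ?lte_fin// -EFinM.
  rewrite (_ : 32 * h * 8^-1 = 4 * h)%R; last by field.
  apply: le_trans tenth; apply: le_trans (integral_exit_le diffY Ia Ib al0 _).
    by apply: markov_bound => //; [exact: measurable_exit|move=> f; exact: exit_ge0].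
  by rewrite !ltW.
apply: le_trans (exit_tail (ltW h320) _ tail n Iy _).
- apply: le_measure; rewrite ?inE; last 2 first.
  + exact: measurable_exit_gt.
  + move=> f /=; rewrite /step_time.
    by case: (exit _ _ f) (exit_ge0 (y - al)%R (y + al)%R f) => [t| |]//= _ _; rewrite ltry.
  rewrite (_ : mkset _ = step_time y al @^-1` [set` `]n%:R * (32 * h), +oo[%R]).
    rewrite -[X in measurable X]setTI.
    exact: (measurable_step_time y al measurableT (measurable_itv _)).
  by apply/seteqP; split => f /=; rewrite in_itv /= andbT.
- by rewrite invr_ge0.
- by apply/andP; split; lra.
Qed.

Lemma integral_step_time y al : I (y - al)%R -> I (y + al)%R ->
  (0 < al)%R ->
  \int[Q y]_f (step_time y al f)%:E = (2^-1)%:E * tent_integral m y al.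
Proof.
move=> Ia Ib al0; rewrite -(integral_exit_center diffY Ia Ib al0).
have ayb : (y - al < y < y + al)%R by apply/andP; split; lra.
apply: ge0_ae_eq_integral => //.
- by apply/measurable_EFinP; exact: measurable_step_time.
- exact: measurable_exit.
- by move=> f _; rewrite lee_fin step_time_ge0.
- by move=> f _; exact: exit_ge0.
exists (~` [set f | exit (y - al)%R (y + al)%R f < +oo]); split.
- by apply: measurableC; exact: measurable_exit_fin.
- rewrite [LHS]probability_setC; last exact: measurable_exit_fin.
  by rewrite exit_finite// subee.
move=> f /= nf eoo; apply: nf => _; rewrite /step_time fineK//.
by rewrite ge0_fin_numE// exit_ge0.
Qed.

(** Expand (s + T - h)^2 as s^2 + 2 s (T - h) + (T - h)^2, where T is the duration
of the step. The mean of T - h is at most e h in absolute value, and (T - h)^2 is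
at most T^2 + h^2; the constant is 7169 = 7 * 32^2 + 1. *)
Lemma step_square y al h e s : I (y - al)%R -> I (y + al)%R -> I y ->
  (0 < al)%R -> (0 < h)%R -> (e <= 1)%R ->
  `|(2^-1)%:E * tent_integral m y al - h%:E| <= (e * h)%:E ->
  \int[Q y]_f ((s + step_time y al f - h) ^+ 2)%:E <=
  (s ^+ 2 + 2 * `|s| * e * h + 7169 * h ^+ 2)%:E.
Proof.
move=> Ia Ib Iy al0 h0 e1 tenth.
have tent0 : 0 <= tent_integral m y al.
  apply: integral_ge0 => u; rewrite /= in_itv /= => /andP[au ub].
  by rewrite lee_fin subr_ge0 ler_norml; apply/andP; split; lra.
have [g gE] : exists g, tent_integral m y al = g%:E.
  case: (tent_integral m y al) tent0 tenth => [g| |]//=; first by exists g.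
  by rewrite gt0_muley ?lte_fin.
rewrite gE -EFinM -EFinB /= lee_fin in tenth.
have g4h : tent_integral m y al <= (4 * h)%:E.
  rewrite gE lee_fin; move: tenth; rewrite ler_norml => /andP[_].
  have : (e * h <= h)%R by rewrite ler_piMl// ltW.
  lra.
have ET := integral_step_time Ia Ib al0; rewrite gE -EFinM in ET.
have ET2 := step_second_moment Ia Ib Iy al0 h0 g4h.
have mT : measurable_fun setT (step_time y al : path_space R -> R).
  exact: measurable_step_time.
have iT : (Q y).-integrable setT (fun f => (step_time y al f)%:E).
  apply/integrableP; split; first exact/measurable_EFinP.
  rewrite (eq_integral (fun f : path_space R => (step_time y al f)%:E)).
    by rewrite ET ltry.
  by move=> f _ /=; rewrite ger0_norm// step_time_ge0.
have iT2 : (Q y).-integrable setT (fun f => ((step_time y al f) ^+ 2)%:E).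
  apply/integrableP; split; first by apply/measurable_EFinP; exact: measurable_funX.
  rewrite (eq_integral (fun f : path_space R => ((step_time y al f) ^+ 2)%:E)).
    by rewrite (le_lt_trans ET2)// ltry.
  by move=> f _ /=; rewrite ger0_norm// sqr_ge0.
pose v := fine (\int[Q y]_f ((step_time y al f) ^+ 2)%:E).
have vE : \int[Q y]_f ((step_time y al f) ^+ 2)%:E = v%:E.
  by rewrite /v fineK//; exact: integrable_fin_num.
rewrite vE lee_fin in ET2.
have ic (c : R) : (Q y).-integrable setT (cst c%:E).
  exact: finite_measure_integrable_cst.
have isT : (Q y).-integrable setT (fun f => (2 * s)%:E * (step_time y al f)%:E).
  exact: integrableZl.
apply: (@le_trans _ _ (\int[Q y]_f (((s ^+ 2 - 2 * s * h + h ^+ 2)%:E +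
    (2 * s)%:E * (step_time y al f)%:E) + ((step_time y al f) ^+ 2)%:E))).
  have ti : (Q y).-integrable setT (fun f => ((s ^+ 2 - 2 * s * h + h ^+ 2)%:E +
    (2 * s)%:E * (step_time y al f)%:E) + ((step_time y al f) ^+ 2)%:E).
    by apply: integrableD => //; apply: integrableD => //; exact: ic.
  have Tpos (f : path_space R) : ((s + step_time y al f - h) ^+ 2)%:E <=
    ((s ^+ 2 - 2 * s * h + h ^+ 2)%:E +
    (2 * s)%:E * (step_time y al f)%:E) + ((step_time y al f) ^+ 2)%:E.
    rewrite -EFinM -!EFinD lee_fin.
    have := mulr_ge0 (ltW h0) (step_time_ge0 y al f); nra.
  apply: ge0_le_integral => //.
  - by move=> f _; rewrite lee_fin sqr_ge0.
  - apply/measurable_EFinP; apply: measurable_funX; apply: measurable_funB => //.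
    exact: measurable_funD.
  - exact: (measurable_int _ ti).
rewrite integralD//; last by apply: integrableD => //; exact: ic.
rewrite integralD//; last exact: ic.
rewrite integral_cst// [X in _ * X + _]probability_setT mule1.
rewrite integralZl// ET vE -EFinM -!EFinD lee_fin.
have sg : (s * (2^-1 * g - h) <= `|s| * (e * h))%R.
  apply: le_trans (ler_norm _) _; rewrite normrM.
  by rewrite ler_wpM2l.
nra.
Qed.

End step_square.

(** * The embedded chain and its clock *)

Section embedding.
Context {R : realType}.
Variable A : R -> R.
Implicit Types (y s h eta : R) (K : set R) (f : path_space R).

Fixpoint chain_at k y f : R :=
  if k is k'.+1 then chain_at k' (step_end y (A y) f) (step_rest y (A y) f)
  else y.

Fixpoint chain_time k y f : R :=
  if k is k'.+1 then
    step_time y (A y) f + chain_time k' (step_end y (A y) f) (step_rest y (A y) f)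
  else 0.

(** The recursion adds T - h to s for each step of duration T, so that for s = 0
it follows chain_time - k h. It does so as long as the chain is in K and the error
is at most eta, and keeps the value at the first violation. Thus a bound for the
final value controls the errors at all earlier steps. *)
Fixpoint clock_error K eta h n y s f : R :=
  if n is n'.+1 then
    if (y \in K) && (`|s| <= eta) then
      clock_error K eta h n' (step_end y (A y) f) (s + step_time y (A y) f - h)
        (step_rest y (A y) f)
    else s
  else s.

Lemma chain_time_ge0 k y f : 0 <= chain_time k y f.
Proof.
by elim: k y f => //= k ih y f; rewrite addr_ge0 ?step_time_ge0.
Qed.

Lemma chain_time_le k k' y f : (k <= k')%N -> chain_time k y f <= chain_time k' y f.
Proof.
elim: k k' y f => [|k ih] [|k'] y f //= kk'; last by rewrite lerD2l ih.
by rewrite addr_ge0 ?step_time_ge0 ?chain_time_ge0.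
Qed.

(** Had some earlier error exceeded eta while the chain was in K, the recursion
would have stopped at it, and the final value would exceed eta. *)
Lemma clock_errorP K eta h n y s f : `|clock_error K eta h n y s f| <= eta ->
  forall k, (k <= n)%N -> (forall j, (j < k)%N -> K (chain_at j y f)) ->
  `|s + chain_time k y f - k%:R * h| <= eta.
Proof.
elim: n y s f => [|n ih] y s f /= err [|k] //= kn Kj.
- by rewrite addr0 mul0r subr0.
- rewrite addr0 mul0r subr0; move: err; case: ifP => [/andP[]//|_ //].
- have yK : y \in K by rewrite inE; exact: (Kj 0%N).
  move: err; rewrite yK /=; case: ifPn => [seta err|/negP//].
  have := ih _ _ _ err k kn (fun j jk => Kj j.+1 jk).
  by rewrite -natr1 mulrDl mul1r; congr (`| _ | <= _); ring.
Qed.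

Lemma measurable_step (G : R -> R * path_space R -> R) y (c : R) :
  (forall z, measurable_fun setT (G z)) ->
  measurable_fun setT (fun sf : R * path_space R =>
    G (step_end y (A y) sf.2)
      (sf.1 + step_time y (A y) sf.2 - c, step_rest y (A y) sf.2)).
Proof.
move=> mG.
have mp : measurable_fun setT (fun sf : R * path_space R =>
    (sf.1 + step_time y (A y) sf.2 - c, step_rest y (A y) sf.2)).
  apply: measurable_fun_pair.
    apply: measurable_funB => //; apply: measurable_funD => //.
    by apply: measurableT_comp => //; exact: measurable_step_time.
  by apply: measurableT_comp => //; exact: measurable_step_rest.
rewrite (_ : (fun _ => _) = fun sf : R * path_space R =>
    if exits_up (y - A y) (y + A y) sf.2 then
      G (y + A y) (sf.1 + step_time y (A y) sf.2 - c, step_rest y (A y) sf.2)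
    else G (y - A y) (sf.1 + step_time y (A y) sf.2 - c, step_rest y (A y) sf.2)).
  apply: measurable_fun_ifT; last 2 first.
  - exact: measurableT_comp.
  - exact: measurableT_comp.
  by apply: measurableT_comp => //; exact: measurable_exits_up.
by apply/funext => sf; rewrite /step_end; case: ifP.
Qed.

Lemma measurable_clock_error K eta h n y :
  measurable_fun setT (fun sf : R * path_space R =>
    clock_error K eta h n y sf.1 sf.2).
Proof.
elim: n y => [|n ih] y /=; first exact: measurable_fst.
case: (y \in K) => /=; last exact: measurable_fst.
apply: measurable_fun_ifT.
- apply: measurable_fun_ler => //.
  by apply: measurableT_comp => //; exact: measurableT_comp.
- exact: (@measurable_step (fun z sf => clock_error K eta h n z sf.1 sf.2)).
- exact: measurable_fst.
Qed.

End embedding.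

Section embedding_laws.
Context {R : realType} {I : set R} {l r : \bar R}.
Context {d : measure_display} {Omega : measurableType d}.
Context {Ft : time R -> set_system Omega} {Py : R -> probability Omega R}.
Context {Y : Omega -> cpath R} {m : {measure set (measurableTypeR R) -> \bar R}}.
Hypothesis diffY : general_diffusion I l r Py Ft Y m.
Implicit Types (a b c x y z s t h e eta : R).
Local Notation Q := (path_law diffY).
Variable A : R -> R.
Hypothesis A_ge0 : forall y, I y -> 0 <= A y.
Hypothesis A_stay : forall y, I y -> I (y - A y) /\ I (y + A y).

(** By [step_square] each step in K adds at most 2 eta e h, from the bias of its
mean, and 7169 h^2, from its second moment; [one_step_integral] gives the
induction over the number of steps. A step length of 0 in K is excluded because
its mean duration 0 is not within e h of h. *)
Lemma clock_error_square K eta h e n y s :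
  0 < h -> 0 <= e < 1 -> 0 <= eta -> K `<=` I ->
  (forall z, K z ->
     `|(2^-1)%:E * tent_integral m z (A z) - h%:E| <= (e * h)%:E)%E ->
  I y ->
  (\int[Q y]_f ((clock_error A K eta h n y s f) ^+ 2)%:E <=
   (s ^+ 2 + n%:R * (2 * eta * e * h + 7169 * h ^+ 2))%:E)%E.
Proof.
move=> h0 /andP[e0 e1] eta0 KI Kh; set b := 2 * eta * e * h + 7169 * h ^+ 2.
have b0 : 0 <= b.
  have hh := sqr_ge0 h; have : 0 <= eta * e * h by rewrite !mulr_ge0// ltW.
  rewrite /b; lra.
elim: n y s => [|n ih] y s Iy /=.
  by rewrite mul0r addr0 integral_cst// [X in (_ * X)%E]probability_setT mule1.
case: (boolP ((y \in K) && (`|s| <= eta))) => [/andP[yK seta]|_]; last first.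
  rewrite integral_cst// [X in (_ * X)%E]probability_setT mule1 lee_fin lerDl.
  by rewrite mulr_ge0.
have Ky : K y by rewrite inE in yK.
have [Ia Ib] := A_stay Iy.
have A0 : 0 < A y.
  rewrite lt_neqAle A_ge0// andbT; apply/eqP => A0.
  have := Kh _ Ky; rewrite -A0 /tent_integral subr0 addr0 set_itvoo0.
  rewrite integral_set0 mule0 sub0e abseN /= lee_fin gtr0_norm//.
  by rewrite -[leLHS]mul1r ler_pM2r// leNgt e1.
pose G z (tf : R * path_space R) :=
  (((clock_error A K eta h n z (s + tf.1 - h) tf.2) ^+ 2)%:E : \bar R).
pose u t := ((s + t - h) ^+ 2 + n%:R * b)%:E.
have mG z : measurable_fun setT (G z).
  apply/measurable_EFinP; apply: measurable_funX.
  apply: (measurableT_comp (f := fun sf : R * path_space R =>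
    clock_error A K eta h n z sf.1 sf.2) (measurable_clock_error _ _ _ _ _ _)
    (g := fun tf : R * path_space R => (s + tf.1 - h, tf.2))).
  apply: measurable_fun_pair => //; apply: measurable_funB => //.
  exact: measurable_funD.
have mu : measurable_fun setT u.
  apply/measurable_EFinP; apply: measurable_funD => //.
  apply: measurable_funX; apply: measurable_funB => //.
  exact: measurable_funD.
have G0 z tf : (0 <= G z tf)%E by rewrite lee_fin sqr_ge0.
have u0 t : (0 <= u t)%E by rewrite lee_fin addr_ge0 ?sqr_ge0// mulr_ge0.
have Gu t z : I z -> (\int[Q z]_f G z (t, f) <= u t)%E by move=> Iz; exact: (ih z (s + t - h) Iz).
apply: (le_trans (one_step_integral Iy A0 Ia Ib mG G0 mu u0 Gu)).
rewrite /u (eq_integral (fun f : path_space R =>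
  ((s + step_time y (A y) f - h) ^+ 2)%:E + (n%:R * b)%:E)%E) //.
rewrite ge0_integralD//; last 3 first.
- by move=> f _; rewrite lee_fin sqr_ge0.
- apply/measurable_EFinP; apply: measurable_funX; apply: measurable_funB => //.
  by apply: measurable_funD => //; exact: measurable_step_time.
- by move=> f _; rewrite lee_fin mulr_ge0.
rewrite integral_cst// [X in (_ + _ * X)%E]probability_setT mule1.
apply: (@le_trans _ _ ((s ^+ 2 + b)%:E + (n%:R * b)%:E)%E).
  rewrite leeD2r//.
  apply: (le_trans (step_square diffY s Ia Ib Iy A0 h0 (ltW e1) (Kh _ Ky))).
  rewrite lee_fin -addrA lerD2l lerD2r.
  by rewrite !ler_wpM2r ?(ltW h0)// ler_wpM2l.
rewrite -EFinD lee_fin -natr1 mulrDl mul1r; lra.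
Qed.

(** Chebyshev's inequality; together with [clock_errorP] this acts as a maximal
inequality. *)
Lemma clock_error_probability K eta h e n y :
  0 < h -> 0 <= e < 1 -> 0 < eta -> K `<=` I ->
  (forall z, K z ->
     `|(2^-1)%:E * tent_integral m z (A z) - h%:E| <= (e * h)%:E)%E ->
  I y ->
  (Q y [set f | (eta < `|clock_error A K eta h n y 0 f|)%R] <=
   ((n%:R * (2 * eta * e * h + 7169 * h ^+ 2)) / eta ^+ 2)%:E)%E.
Proof.
move=> h0 e01 eta0 KI Kh Iy.
have eta20 : 0 < eta ^+ 2 by rewrite exprn_gt0.
have mc : measurable_fun setT (fun f : path_space R => clock_error A K eta h n y 0 f).
  exact: (measurable_fun_pair2 (f := fun sf : R * path_space R =>
    clock_error A K eta h n y sf.1 sf.2) 0 (measurable_clock_error A K eta h n y)).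
rewrite -(@lee_pmul2l _ (eta ^+ 2)%:E) ?lte_fin// -EFinM.
rewrite [X in (_ <= X%:E)%E]mulrC divfK ?gt_eqF//.
have := clock_error_square n 0 h0 e01 (ltW eta0) KI Kh Iy.
rewrite expr0n add0r; apply: le_trans.
have := @markov_bound _ _ _ (Q y)
  (fun f => ((clock_error A K eta h n y 0 f) ^+ 2)%:E) _ eta20.
rewrite (_ : [set x | _] = [set f | (eta < `|clock_error A K eta h n y 0 f|)%R]).
  apply; first by apply/measurable_EFinP; exact: measurable_funX.
  by move=> f; rewrite lee_fin sqr_ge0.
have sqE f : (((eta ^+ 2)%:E < (clock_error A K eta h n y 0 f ^+ 2)%:E)%E) =
    (eta < `|clock_error A K eta h n y 0 f|).
  by rewrite lte_fin -[ltRHS]real_normK ?num_real// ltr_sqr// nnegrE// ltW.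
by apply/seteqP; split => f /=; rewrite sqE.
Qed.

End embedding_laws.

(** * Almost sure properties of the embedded chain *)

Lemma probability1_ae {R : realType} d (X : measurableType d)
    (P : probability X R) (S : set X) (H : X -> Prop) :
  measurable S -> P S = 1%E -> (forall x, S x -> H x) -> {ae P, forall x, H x}.
Proof.
move=> mS PS SH; exists (~` S); split.
- exact: measurableC.
- by rewrite [LHS]probability_setC// PS subee.
- by move=> x /= nH; apply: contra_not nH; exact: SH.
Qed.

Section chain_on_path.
Context {R : realType} {I : set R} {l r : \bar R}.
Context {d : measure_display} {Omega : measurableType d}.
Context {Ft : time R -> set_system Omega} {Py : R -> probability Omega R}.
Context {Y : Omega -> cpath R} {m : {measure set (measurableTypeR R) -> \bar R}}.
Hypothesis diffY : general_diffusion I l r Py Ft Y m.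
Implicit Types (a b c x y z s t h e eta : R).
Local Notation Q := (path_law diffY).

Section chain.
Variable A : R -> R.
Hypothesis A_ge0 : forall y, I y -> 0 <= A y.
Hypothesis A_stay : forall y, I y -> I (y - A y) /\ I (y + A y).

Lemma measurable_step_fun (G : R -> path_space R -> R) y :
  (forall z, measurable_fun setT (G z)) ->
  measurable_fun setT (fun f : path_space R =>
    G (step_end y (A y) f) (step_rest y (A y) f)).
Proof.
move=> mG; rewrite (_ : (fun _ => _) = fun f : path_space R =>
    if exits_up (y - A y) (y + A y) f then G (y + A y) (step_rest y (A y) f)
    else G (y - A y) (step_rest y (A y) f)).
  apply: measurable_fun_ifT; first exact: measurable_exits_up.
  - by apply: measurableT_comp => //; exact: measurable_step_rest.
  - by apply: measurableT_comp => //; exact: measurable_step_rest.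
by apply/funext => f; rewrite /step_end; case: ifP.
Qed.

Lemma measurable_chain_at k y : measurable_fun setT (chain_at A k y).
Proof.
by elim: k y => [|k ih] y //=; exact: measurable_step_fun.
Qed.

Lemma measurable_chain_time k y : measurable_fun setT (chain_time A k y).
Proof.
elim: k y => [|k ih] y //=; apply: measurable_funD.
  exact: measurable_step_time.
exact: measurable_step_fun.
Qed.

(** Induction over the number of steps with [one_step]: after the first step the
statement for the path is the statement for its rest. For 0 steps it says that
the path starts at y. *)
Lemma chain_on_path y : I y ->
  {ae Q y, forall f, forall k, chain_at A k y f = ev f (chain_time A k y f)}.
Proof.
move=> Iy.
pose E k z : set (path_space R) :=
  [set f | chain_at A k z f = ev f (chain_time A k z f)].
have mE k z : measurable (E k z).
  rewrite (_ : E k z = (fun f => chain_at A k z f - ev f (chain_time A k z f))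
      @^-1` [set 0]).
    rewrite -[X in measurable X]setTI.
    have mev : measurable_fun setT (fun f : path_space R => ev f (chain_time A k z f)).
      apply: (@measurable_ev_random _ _ _ (fun f : path_space R => f : cpath R)).
        by move=> s; exact: measurable_ev.
      exact: measurable_chain_time.
    have mB : measurable_fun setT (fun f : path_space R =>
        chain_at A k z f - ev f (chain_time A k z f)).
      by apply: measurable_funB => //; exact: measurable_chain_at.
    exact: (mB measurableT).
  apply/seteqP; split => f; rewrite /E /=; last exact: subr0_eq.
  by move=> ->; exact: subrr.
have QE k z : I z -> Q z (E k z) = 1%E.
  elim: k z => [|k ih] z Iz.
    rewrite -[RHS](path_law_start diffY Iz); congr (Q z _).
    by apply/seteqP; split => f.
  rewrite (_ : E k.+1 z = [set f | E k (step_end z (A z) f) (step_rest z (A z) f)]).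
    have [Ia Ib] := A_stay Iz.
    rewrite (one_step diffY Iz (A_ge0 Iz) Ia Ib (mE k)).
    by rewrite !ih// !mule1 -EFinD; congr EFin; lra.
  by apply/seteqP; split => f; 
    rewrite /E /= -(@ev_shift _ (step_time z (A z) f)) ?chain_time_ge0.
apply: ae_foralln => k; apply: (probability1_ae (mE k y)); first exact: QE.
by [].
Qed.

End chain.

(** Rational times make this event measurable. *)
Definition constant_path z : set (path_space R) :=
  \bigcap_(q : rat) [set f | ev f (ratr q) = z].

Lemma constant_pathP z (f : path_space R) : constant_path z f <-> forall t, ev f t = z.
Proof.
split=> [fz t|fz q _ //=].
apply/eqP; rewrite -subr_eq0 -normr_le0; apply/ler_addgt0Pl => e e0; rewrite addr0.
have /cvgrPdist_le/(_ _ e0)/nbhs_ballP[dl /= dl0 fdl] := @ev_continuous _ f t.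
have /rat_in_itvoo[q] : t < t + dl by rewrite ltrDl.
rewrite in_itv /= => /andP[tq qt].
by rewrite -(fz q Logic.I); apply: fdl; rewrite /ball /= ltr_norml; lra.
Qed.

Lemma measurable_constant_path z : measurable (constant_path z).
Proof.
rewrite /constant_path -[X in measurable X]setCK setC_bigcap; apply: measurableC.
apply: bigcupT_measurable_rat => q; apply: measurableC; exact: measurable_ev_eq.
Qed.

(** The strong Markov property at the hitting time of z: the rest of the path has
the law of the diffusion started at z, which is constant. *)
Lemma absorbed_ae y z : I y -> I z -> z%:E = l \/ z%:E = r ->
  {ae Q y, forall f, forall s t, 0 <= s <= t -> ev f s = z -> ev f t = z}.
Proof.
move=> Iy Iz zlr.
pose H := [set f : path_space R | hitting_time z%:E f < +oo]%E.
have mH : measurable H by exact: measurable_hitting_fin.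
pose B := [set f : path_space R | constant_path z
  (shift_path (fine (hitting_time z%:E f)) f)].
have mB : measurable B.
  apply: (measurable_shifted _ (measurable_constant_path z)).
  by apply: measurableT_comp => //; exact: measurable_hitting_time.
have Qz : Q z (constant_path z) = 1%E.
  rewrite path_lawE -(gd_absorbing diffY Iz zlr); congr (Py z _).
  apply/seteqP; split => w /=.
    by move=> /constant_pathP wz t; rewrite -ev_val.
  by move=> wz; apply/constant_pathP => t; exact: wz.
apply: (@probability1_ae _ _ _ _ (~` H `|` (H `&` B))).
- apply: measurableU; first exact: measurableC.
  exact: measurableI.
- rewrite measureU//; last 3 first.
  + exact: measurableC.
  + exact: measurableI.
  + by apply/seteqP; split => // f [nH []].
  rewrite [X in (_ + X)%E]strong_markov_hitting//; last exact: measurable_constant_path.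
  rewrite Qz mule1 [X in (X + _)%E]probability_setC// subeK//.
  by rewrite fin_num_measure.
- move=> f HB s t /andP[s0 st] fs.
  have hz : (hitting_time z%:E f <= s%:E)%E.
    by apply/hitting_time_le => //; exists s; rewrite // s0 lexx.
  have hoo : (hitting_time z%:E f < +oo)%E by rewrite (le_lt_trans hz) ?ltry.
  have hf := hitting_time_fin hoo.
  have [//|[_ /constant_pathP fB]] := HB.
  have h0 := fine_ge0 (hitting_time_ge0 z%:E f).
  have hs : fine (hitting_time z%:E f) <= s by rewrite -lee_fin fineK.
  rewrite -(fB (t - fine (hitting_time z%:E f))) ev_shift.
    by rewrite addrC subrK.
  by rewrite subr_ge0 (le_trans hs).
Qed.

End chain_on_path.

(** * Convergence on single paths *)

Section pathwise_convergence.
Context {R : realType}.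
Implicit Types (f : cpath R) (s t e T : R) (O : set R).

(** Let sg be the first time outside O. If sg > T, take S = T. Otherwise the path
is constant from sg on, and by continuity it is already nearly constant from
shortly before sg on; take S slightly before sg. *)
Lemma path_settles f O T e : open O -> O (ev f 0) ->
  (forall s t, 0 <= s <= t -> ~ O (ev f s) -> ev f t = ev f s) -> 0 < e -> 0 <= T ->
  exists S dl, [/\ 0 <= S, 0 < dl, (forall s, 0 <= s <= S -> O (ev f s)) &
    T <= S \/ forall s t, 0 <= s -> S - dl <= s -> 0 <= t -> S - dl <= t ->
      `|ev f s - ev f t| <= e].
Proof.
move=> oO O0 stay e0 T0.
have [OT|] := pselect (forall s, 0 <= s <= T -> O (ev f s)).
  by exists T, 1; split => //; left.
move=> /existsNP[b0 /not_implyP[/andP[b00 b0T] Ob0]].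
pose B := [set s | 0 <= s /\ ~ O (ev f s)].
have B0 : B !=set0 by exists b0.
have lB : has_lbound B by exists 0 => s [].
have infB : has_inf B by split.
pose sg := inf B.
have sg0 : 0 <= sg by apply: lb_le_inf => // s [].
have Osg : ~ O (ev f sg).
  move=> Osg; have : nbhs sg (ev f @^-1` O).
    by apply: ev_continuous; exact: open_nbhs_nbhs.
  move=> /nbhs_ballP[dl /= dl0 fO].
  have [b [b1 b2] bsg] := inf_adherent dl0 infB.
  apply: (b2); apply: fO; rewrite /ball /= ltr_norml.
  have : sg <= b by exact: (ge_inf lB (conj b1 b2)).
  lra.
have sg_gt0 : 0 < sg.
  by rewrite lt_neqAle sg0 andbT; apply/eqP => sgE; apply: Osg; rewrite -sgE.
have e20 : 0 < e / 2 by rewrite divr_gt0.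
have /cvgrPdist_lt/(_ _ e20)/nbhs_ballP[dl /= dl0 fdl] := @ev_continuous _ f sg.
(* Not beyond sg, so that S = sg - k / 4 is nonnegative. *)
pose k := Num.min dl sg.
have k0 : 0 < k by rewrite lt_min dl0.
have kdl : k <= dl by rewrite ge_min lexx.
have ksg : k <= sg by rewrite ge_min lexx orbT.
have near_end s : 0 <= s -> sg - k / 4 - k / 4 <= s -> `|ev f sg - ev f s| <= e / 2.
  move=> s0 ss; have [sgs|ssg] := leP sg s.
    by rewrite (stay sg s) ?sg0// subrr normr0 ltW.
  apply/ltW/fdl; rewrite /ball /= ltr_norml; lra.
exists (sg - k / 4), (k / 4); split.
- lra.
- lra.
- move=> s /andP[s0 ss]; apply: contrapT => Os.
  have : sg <= s by exact: (ge_inf lB (conj s0 Os)).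
  lra.
right => s t s0 ss t0 tt.
rewrite (le_trans (ler_distD (ev f sg) _ _))// distrC.
have := near_end s s0 ss; have := near_end t t0 tt; lra.
Qed.

(** Here x n k is the k-th observation, made at time t n k. With S from
[path_settles] the path up to time S stays in a compact subset of O, hence in
K n for large n. As long as all earlier observations are made before S, the
clocks agree. Once an observation is made after S, so are all later ones, and
their nominal times k h n also lie after S, up to an error that tends to 0; then
the path is nearly constant on all times concerned. *)
Lemma embedded_interpolation_cvg f O (h : nat -> R) (x t : nat -> nat -> R)
    (N : nat -> nat) (K : nat -> set R) :
  open O -> O (ev f 0) ->
  (forall s t, 0 <= s <= t -> ~ O (ev f s) -> ev f t = ev f s) ->
  (forall n, 0 < h n) -> h @ \oo --> 0 ->
  (forall n k, x n k = ev f (t n k)) -> (forall n k, 0 <= t n k) ->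
  (forall n j k, (j <= k)%N -> t n j <= t n k) ->
  (forall n, n.+1%:R <= (N n)%:R * h n) ->
  (forall C, compact C -> C `<=` O -> \forall n \near \oo, C `<=` K n) ->
  (\forall n \near \oo, forall k, (k <= N n)%N -> (forall j, (j < k)%N -> K n (x n j)) ->
     `|t n k - k%:R * h n| <= n.+1%:R^-1) ->
  (fun n => interpolation (h n) (x n)) @ \oo --> f.
Proof.
move=> oO O0 stay h0 hcvg xE t0 tmono NE KO ctrl.
apply: cpath_cvg => T e e0.
wlog T0 : T / 0 <= T.
  move=> W; have := W (Num.max T 0) _; rewrite le_max lexx orbT => /(_ isT).
  apply: filterS => n Wn s /andP[s0 sT]; apply: Wn.
  by rewrite s0 le_max sT.
have T10 : 0 <= T + 1 by rewrite addr_ge0.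
have [S [dl [S0 dl0 fO tail]]] := path_settles oO O0 stay e0 T10.
have [d1 d10 fd1] := ev_unif_continuous f T e0.
pose C := ev f @` `[0, S]%classic.
have cC : compact C.
  apply: continuous_compact; last exact: segment_compact.
  by apply: continuous_subspaceT; exact: ev_continuous.
have CO : C `<=` O by move=> _ [s /= + <-]; rewrite in_itv /=; exact: fO.
have CK := KO _ cC CO.
have dmin0 : 0 < Num.min (Num.min d1 dl) 1 / 2.
  by rewrite divr_gt0// !lt_min d10 dl0 ltr01.
near=> n => s /andP[s0 sT].
have CKn : C `<=` K n by near: n; exact: CK.
have ctrln : forall k, (k <= N n)%N -> (forall j, (j < k)%N -> K n (x n j)) ->
     `|t n k - k%:R * h n| <= n.+1%:R^-1.
  by near: n; exact: ctrl.
have eta_small : n.+1%:R^-1 < Num.min (Num.min d1 dl) 1 / 2.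
  by near: n; exact: (cvgr_lt _ cvg_invn).
have h_small : h n < Num.min (Num.min d1 dl) 1 / 2.
  by near: n; exact: (cvgr_lt _ hcvg).
have Tn : T + 1 <= n.+1%:R.
  near: n; have := nbhs_infty_ger (T + 1); apply: filterS => n /le_trans; apply.
  by rewrite ler_nat.
set eta := n.+1%:R^-1 in ctrln eta_small *.
set dm := Num.min (Num.min d1 dl) 1 in eta_small h_small.
have dm1 : dm <= 1 by rewrite ge_min lexx orbT.
have dmd1 : dm <= d1 by rewrite !ge_min lexx.
have dmdl : dm <= dl by rewrite !ge_min lexx orbT.
have hn0 := h0 n.
(* Either the clocks still agree at step k, or an observation has been made
   after S and the nominal time of step k is not much before S. *)
have clock k : (k <= N n)%N -> `|t n k - k%:R * h n| <= eta \/
    (S < t n k /\ S - eta < k%:R * h n).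
  elim: k => [|k ih] kN.
    by left; apply: ctrln.
  have [|] := pselect (forall j, (j < k.+1)%N -> t n j <= S).
    move=> tS; left; apply: ctrln => // j jk; apply: CKn; rewrite xE.
    by exists (t n j) => //=; rewrite in_itv /= t0 tS.
  move=> /existsNP[j /not_implyP[jk /negP]]; rewrite -ltNge => Sj; right.
  have Sk : S < t n k by apply: (lt_le_trans Sj); apply: tmono.
  split; first by apply: (lt_le_trans Sk); apply: tmono.
  rewrite -natr1 mulrDl mul1r.
  have [|[_]] := ih (ltnW kN); last lra.
  by rewrite ler_norml; lra.
have near_k k : (k <= N n)%N -> `|s - k%:R * h n| <= h n ->
    `|x n k - ev f s| <= e.
  move=> kN; rewrite ler_norml => /andP[ks1 ks2]; rewrite xE.
  have [|[Sk1 Sk2]] := clock k kN.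
    rewrite ler_norml => /andP[c1 c2]; rewrite distrC ltW//; apply: fd1.
      by rewrite s0.
    by rewrite ltr_norml; lra.
  have [TS|tl] := tail; first by exfalso; lra.
  apply: tl => //; lra.
have sh0 : 0 <= s / h n by rewrite divr_ge0// ltW.
have := truncn_itv sh0; set k := Num.truncn _ => /andP[].
rewrite -[k.+1%:R]natr1 ler_pdivlMr// ltr_pdivrMr// mulrDl mul1r => k1 k2.
have kN : (k < N n)%N.
  rewrite -(ltr_nat R) -(ltr_pM2r hn0); have := NE n; lra.
apply: interpolation_near => //; rewrite -/k; apply: near_k => //.
- exact: ltnW.
- by rewrite ler_norml; lra.
- by rewrite -natr1 mulrDl mul1r ler_norml; lra.
Unshelve. all: by end_near. Qed.

End pathwise_convergence.

(** * Integrals of bounded functions *)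

Section integral_lemmas.
Local Open Scope ereal_scope.
Import HBNNSimple.

(** The integral of a nonmeasurable function is a supremum over the simple
functions below it, and those below f and g are the same up to multiplication
with the indicator of the complement of N. *)
Lemma ge0_integral_eq_off_null {R : realType} d (X : measurableType d)
    (mu : {measure set X -> \bar R}) (N : set X) (f g : X -> \bar R) :
  measurable N -> mu N = 0 -> (forall x, 0 <= f x) -> (forall x, 0 <= g x) ->
  (forall x, ~ N x -> f x = g x) -> \int[mu]_x f x = \int[mu]_x g x.
Proof.
move=> mN N0.
have le_int (f1 f2 : X -> \bar R) : (forall x, 0 <= f1 x) -> (forall x, 0 <= f2 x) ->
    (forall x, ~ N x -> f1 x = f2 x) -> \int[mu]_x f1 x <= \int[mu]_x f2 x.
  move=> f10 f20 f12; rewrite !ge0_integralTE//.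
  apply: ge_ereal_sup => _ [h /= hf1 <-].
  pose h' := proj_nnsfun h (measurableC mN).
  apply: ereal_sup_ubound; exists h' => /=.
    move=> x; rewrite /h' /= /proj_nnsfun /=.
    have [xN|xN] := pselect (N x).
      by rewrite mindicE memNset ?mulr0 //.
    by rewrite mindicE mem_set// mulr1 -f12.
  rewrite -!integralT_nnsfun.
  apply: ge0_ae_eq_integral => //.
  - by apply/measurable_EFinP.
  - by apply/measurable_EFinP.
  - by move=> x _; rewrite lee_fin.
  - by move=> x _; rewrite lee_fin.
  exists N; split => // x /=; apply: contra_notP => xN _.
  by rewrite /h' /= mindicE mem_set// mulr1.
move=> f0 g0 fg; apply/eqP; rewrite eq_le !le_int// => x xN.
by rewrite fg.
Qed.

Lemma integral_eq_off_null {R : realType} d (X : measurableType d)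
    (mu : {measure set X -> \bar R}) (N : set X) (f g : X -> \bar R) :
  measurable N -> mu N = 0 -> (forall x, ~ N x -> f x = g x) ->
  \int[mu]_x f x = \int[mu]_x g x.
Proof.
move=> mN N0 fg; rewrite integralE [RHS]integralE; congr (_ - _).
  apply: (ge0_integral_eq_off_null mN N0) => // x xN.
  by rewrite !funeposE fg.
apply: (ge0_integral_eq_off_null mN N0) => // x xN.
by rewrite !funenegE fg.
Qed.

Lemma bounded_integrable {R : realType} d (X : measurableType d)
    (P : probability X R) (Z : X -> R) (M : R) :
  measurable_fun setT Z -> (forall x, `|Z x| <= M)%R ->
  P.-integrable setT (fun x => (Z x)%:E).
Proof.
move=> mZ ZM.
apply: (@le_integrable _ _ _ _ _ measurableT _ (cst M%:E)).
- exact/measurable_EFinP.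
- by move=> x _; rewrite /= lee_fin (le_trans (ZM x))// ler_norm.
- exact: finite_measure_integrable_cst.
Qed.

Lemma eq_law_integral {R : realType} d1 d2 (X1 : measurableType d1)
    (X2 : measurableType d2) (P1 : probability X1 R) (P2 : probability X2 R)
    (Z1 : X1 -> R) (Z2 : X2 -> R) (M : R) :
  measurable_fun setT Z1 -> measurable_fun setT Z2 ->
  (forall x, `|Z1 x| <= M)%R -> (forall x, `|Z2 x| <= M)%R ->
  (forall B, measurable B -> P1 (Z1 @^-1` B) = P2 (Z2 @^-1` B)) ->
  \int[P1]_x (Z1 x)%:E = \int[P2]_x (Z2 x)%:E.
Proof.
move=> mZ1 mZ2 M1 M2 law.
have E1 := @integral_pushforward _ _ _ _ _ _ mZ1 P1 setT EFin
  (@EFin_measurable _ _) (bounded_integrable P1 mZ1 M1) measurableT.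
have E2 := @integral_pushforward _ _ _ _ _ _ mZ2 P2 setT EFin
  (@EFin_measurable _ _) (bounded_integrable P2 mZ2 M2) measurableT.
rewrite preimage_setT in E1; rewrite preimage_setT in E2.
transitivity (\int[pushforward P1 Z1]_y y%:E); first by rewrite E1.
transitivity (\int[pushforward P2 Z2]_y y%:E); last by rewrite E2.
by apply: eq_measure_integral => B mB _; exact: law.
Qed.

Lemma bounded_cvg_integral {R : realType} d (X : measurableType d)
    (P : probability X R) (Z_ : nat -> X -> R) (Z : X -> R) (M : R) :
  (forall n, measurable_fun setT (Z_ n)) -> measurable_fun setT Z ->
  (forall n x, `|Z_ n x| <= M)%R ->
  {ae P, forall x, (Z_ n x @[n --> \oo] --> Z x)%R} ->
  \int[P]_x (Z_ n x)%:E @[n --> \oo] --> \int[P]_x (Z x)%:E.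
Proof.
move=> mZ_ mZ ZM ZZ.
have f_f : {ae P, forall x, [set: X] x -> (Z_ n x)%:E @[n --> \oo] --> (Z x)%:E}.
  by apply: filterS ZZ => x Zx _; apply: cvg_EFin => //; exact: nearW.
have ig : P.-integrable setT (cst M%:E) by exact: finite_measure_integrable_cst.
have f_g : {ae P, forall x n, [set: X] x -> `|(Z_ n x)%:E| <= cst M%:E x}.
  by apply: nearW => x n _ /=; rewrite lee_fin.
by have [] := dominated_convergence measurableT
  (fun n => (measurable_EFinP _ _).2 (mZ_ n)) ((measurable_EFinP _ _).2 mZ)
  f_f ig f_g.
Qed.

End integral_lemmas.

(** * The law of the embedded chain *)

Section tree_average.
Context {R : realType}.
Variable A : R -> R.
Implicit Types (y : R) (S : set (nat -> R)) (e : nat -> bool).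

Definition path_cons y (x : nat -> R) : nat -> R :=
  fun k => if k is k'.+1 then x k' else y.

(** The law of the chain stopped after n steps, as a weight on its binary tree of positions,
with no probability space involved: the common value of the laws of the chain
driven by xi and of the embedded chain. *)
Fixpoint tree_average n y S : R :=
  if n is n'.+1 then
    2^-1 * tree_average n' (y + A y) [set x | S (path_cons y x)] +
    2^-1 * tree_average n' (y - A y) [set x | S (path_cons y x)]
  else (`[< S (fun=> y) >])%:R.

Definition sign (b : bool) : R := if b then 1 else -1.

(** The chain [embedded_chain] driven by signs, as a recursion over the first step
instead of the last one. *)
Fixpoint sign_chain k y e : R :=
  if k is k'.+1 then sign_chain k' (y + A y * sign (e 0%N)) (fun i => e i.+1)
  else y.

Lemma embedded_chain_sign (b : \bar R -> R) y e k : (forall z, A z = b z%:E) ->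
  embedded_chain b y (sign \o e) k = sign_chain k y e.
Proof.
move=> Ab.
have step j : forall y' (e' : nat -> R), embedded_chain b y' e' j.+1 =
    embedded_chain b (y' + b y'%:E * e' 0%N) (fun i => e' i.+1) j.
  by elim: j => [//|j ih] y' e'; rewrite [LHS]/= -/(embedded_chain b y' e' j.+1) ih.
elim: k y e => [//|k ih] y e; rewrite step /= -ih; congr (embedded_chain b _ _ k).
by rewrite Ab.
Qed.

Lemma stopped_chain_cons n y (x : nat -> R) (z : nat -> R) :
  x 0%N = y -> (forall k, x k.+1 = z k) ->
  (fun k => x (minn k n.+1)) = path_cons y (fun k => z (minn k n)).
Proof. by move=> x0 xz; apply/funext => -[|k] //=; rewrite minnSS xz. Qed.

End tree_average.

Section signs_law.
Context {R : realType} d (T : measurableType d) (P : probability T R).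
Variable xi : nat -> {RV P >-> R}.
Hypothesis iid_xi : iid_signs xi.
Variable A : R -> R.
Implicit Types (y : R) (S : set (nat -> R)) (e : nat -> bool).

(** Only the value 1 is read as heads. Off a null event the other values are -1,
and on that null event, where the chain driven by xi itself may leave the state
space, this choice keeps everything measurable. *)
Definition heads (k : nat) (w : T) : bool := xi k w == 1.

Lemma measurable_heads k (b : bool) : measurable [set w | heads k w = b].
Proof.
have m1 : measurable [set w | heads k w = true].
  rewrite (_ : mkset _ = xi k @^-1` [set 1]); first exact: measurable_funPTI.
  by apply/seteqP; split => w /eqP.
case: b => //; rewrite (_ : mkset _ = ~` [set w | heads k w = true]).
  exact: measurableC.
by apply/seteqP; split => w /= => [->//|/negP/negbTE].
Qed.

Definition heads_cylinder j e := [set w | forall i, (i < j)%N -> heads i w = e i].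

Lemma heads_cylinderS j e (b : bool) : e j = b ->
  heads_cylinder j.+1 e = heads_cylinder j e `&` [set w | heads j w = b].
Proof.
move=> ej; apply/seteqP; split => w /=.
  by move=> we; split; [move=> i ij; apply: we; exact: ltnW|rewrite we].
move=> [we wj] i; rewrite ltnS leq_eqVlt => /orP[/eqP ->|]; last exact: we.
by rewrite wj ej.
Qed.

Lemma measurable_heads_cylinder j e : measurable (heads_cylinder j e).
Proof.
elim: j => [|j ih].
  by rewrite (_ : heads_cylinder 0 e = setT)//; apply/seteqP; split.
rewrite (@heads_cylinderS _ _ (e j))//; apply: measurableI => //.
exact: measurable_heads.
Qed.

Lemma heads_cylinder_law j e : P (heads_cylinder j e) = ((2^-1) ^+ j)%:E.
Proof.
pose J : {fset nat} := seq_fset tt (iota 0 j).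
pose B k : set R := if e k then [set 1] else ~` [set 1].
have mB k : measurable (B k) by rewrite /B; case: (e k) => //; exact: measurableC.
have half k : P [set w | B k (xi k w)] = (2^-1)%:E.
  have [h1 _] := signs_law iid_xi k.
  rewrite /B; case: (e k) => //.
  rewrite (_ : mkset _ = ~` [set w | xi k w = 1])//.
  have m1 : measurable [set w | xi k w = 1].
    by rewrite -[mkset _]/(xi k @^-1` [set 1]); exact: measurable_funPTI.
  by rewrite [LHS]probability_setC// h1 -EFinB; congr EFin; lra.
have := signs_independent iid_xi J mB.
rewrite (eq_bigr (fun=> (2^-1)%:E)); last by move=> k _; exact: half.
rewrite (perm_big (iota 0 j)); last first.
  by rewrite (perm_trans (seq_fset_perm _ _))// undup_id// iota_uniq.
rewrite big_const_seq count_predT size_iota.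
rewrite (_ : iter j _ _ = ((2^-1) ^+ j)%:E); last first.
  by elim: j {J} => //= j ->; rewrite exprS EFinM.
move=> <-; congr (P _); apply/seteqP; split => w /=.
  move=> we k /=; rewrite seq_fsetE mem_iota add0n => /andP[_ kj].
  have := we k kj; rewrite /B /heads; case: (e k) => [/eqP//|/negbT/eqP//].
move=> wB i ij; have := wB i; rewrite /= seq_fsetE mem_iota add0n ij => /(_ isT).
by rewrite /B /heads; case: (e i) => [->|/eqP/negbTE]//; rewrite eqxx.
Qed.

(** Fixing the first j signs, and shifting the driving sequence by j, makes the
induction over n possible: the next sign becomes part of the fixed ones. *)
Lemma sign_chain_law n y S j e :
  measurable [set w | S (fun k => sign_chain A (minn k n) y
    (fun i => heads (j + i) w))] /\
  P (heads_cylinder j e `&` [set w | S (fun k => sign_chain A (minn k n) y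
    (fun i => heads (j + i) w))]) = ((2^-1) ^+ j * tree_average A n y S)%:E.
Proof.
elim: n y S j e => [|n ih] y S j e.
  rewrite (_ : (fun w => _) = fun=> S (fun=> y)); last first.
    by apply/funext => w; congr S; apply/funext => k; rewrite minn0.
  rewrite /= ; case: asboolP => Sy.
    rewrite (_ : [set _ | _] = setT); last by apply/seteqP; split.
    by rewrite setIT mulr1 heads_cylinder_law.
  rewrite (_ : [set _ | _] = set0); last by apply/seteqP; split.
  by rewrite setI0 mulr0 measure0.
pose E := [set w | S (fun k => sign_chain A (minn k n.+1) y
    (fun i => heads (j + i) w))].
pose E' (b : bool) := [set w | S (path_cons y (fun k => sign_chain A (minn k n)
  (y + A y * sign b) (fun i => heads (j.+1 + i) w)))].
have EE' : E = ([set w | heads j w = true] `&` E' true) `|`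
               ([set w | heads j w = false] `&` E' false).
  have step w : S (fun k => sign_chain A (minn k n.+1) y
      (fun i => heads (j + i) w)) = E' (heads j w) w.
    rewrite -[RHS]/(S _); congr S.
    apply: (@stopped_chain_cons _ n y
      (fun k => sign_chain A k y (fun i => heads (j + i) w))
      (fun k => sign_chain A k (y + A y * sign (heads j w))
        (fun i => heads (j.+1 + i) w))) => // k /=.
    by rewrite addn0; congr sign_chain; apply/funext => i; rewrite addnS.
  apply/seteqP; split => w; rewrite /E /= step.
    by case: (heads j w) => ?; [left|right].
  by move=> [[<-]|[<-]].
pose S' := [set x | S (path_cons y x)].
have mE' b : measurable (E' b) by have [] := ih (y + A y * sign b) S' j.+1 e.
rewrite -/E; split.
  by rewrite EE'; apply: measurableU; apply: measurableI => //; exact: measurable_heads.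
have PE b : P (heads_cylinder j e `&` ([set w | heads j w = b] `&` E' b)) =
    ((2^-1) ^+ j.+1 * tree_average A n (y + A y * sign b) S')%:E.
  pose eb i := if i == j then b else e i.
  have [_ <-] := ih (y + A y * sign b) S' j.+1 eb.
  rewrite (@heads_cylinderS _ _ b); last by rewrite /eb eqxx.
  rewrite setIA; congr (P (_ `&` _ `&` _)); apply/seteqP; split => w /= we i ij.
    by rewrite /eb ltn_eqF// we.
  by rewrite we// /eb ltn_eqF.
have mC b : measurable (heads_cylinder j e `&` ([set w | heads j w = b] `&` E' b)).
  apply: measurableI; first exact: measurable_heads_cylinder.
  by apply: measurableI => //; exact: measurable_heads.
have dC : (heads_cylinder j e `&` ([set w | heads j w = true] `&` E' true)) `&`
    (heads_cylinder j e `&` ([set w | heads j w = false] `&` E' false)) = set0.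
  by apply/seteqP; split => // w [[_ [/= -> _]] [_ []]].
rewrite EE' setIUr measureU//.
rewrite (_ : (_ + _)%E = (((2^-1) ^+ j.+1 * tree_average A n (y + A y * sign true) S')%:E +
  ((2^-1) ^+ j.+1 * tree_average A n (y + A y * sign false) S')%:E)%E); last first.
  by congr (_ + _)%E; exact: PE.
rewrite -EFinD; congr EFin; rewrite /= /sign mulr1 mulrN1 exprSr; ring.
Qed.

End signs_law.

Section chain_law.
Context {R : realType} {I : set R} {l r : \bar R}.
Context {d : measure_display} {Omega : measurableType d}.
Context {Ft : time R -> set_system Omega} {Py : R -> probability Omega R}.
Context {Y : Omega -> cpath R} {m : {measure set (measurableTypeR R) -> \bar R}}.
Hypothesis diffY : general_diffusion I l r Py Ft Y m.
Local Notation Q := (path_law diffY).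
Variable A : R -> R.
Hypothesis A_ge0 : forall y, I y -> 0 <= A y.
Hypothesis A_stay : forall y, I y -> I (y - A y) /\ I (y + A y).
Implicit Types (y : R) (S : set (nat -> R)).

(** The recursion that defines [tree_average] is [one_step]. *)
Lemma chain_law n y S : 
  measurable [set f : path_space R | S (fun k => chain_at A (minn k n) y f)] /\
  (I y -> Q y [set f | S (fun k => chain_at A (minn k n) y f)] =
    (tree_average A n y S)%:E).
Proof.
elim: n y S => [|n ih] y S.
  rewrite (_ : (fun f => _) = fun=> S (fun=> y)); last first.
    by apply/funext => w; congr S; apply/funext => k; rewrite minn0.
  rewrite /= ; case: asboolP => Sy.
    rewrite (_ : [set _ | _] = setT); last by apply/seteqP; split.
    by split => // _; exact: probability_setT.
  rewrite (_ : [set _ | _] = set0); last by apply/seteqP; split.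
  by rewrite measure0.
pose S' := [set x | S (path_cons y x)].
pose B z : set (path_space R) := [set f | S' (fun k => chain_at A (minn k n) z f)].
have mB z : measurable (B z) by have [] := ih z S'.
have EB : [set f : path_space R | S (fun k => chain_at A (minn k n.+1) y f)] =
    [set f | B (step_end y (A y) f) (step_rest y (A y) f)].
  have step f : (fun k => chain_at A (minn k n.+1) y f) = path_cons y
      (fun k => chain_at A (minn k n) (step_end y (A y) f) (step_rest y (A y) f)).
    exact: (@stopped_chain_cons _ n y (fun k => chain_at A k y f)
      (fun k => chain_at A k (step_end y (A y) f) (step_rest y (A y) f))).
  by apply/seteqP; split => f; rewrite /B /S' /= step.
rewrite EB; split.
  apply: (@measurable_step_end_set R y (A y) (fun z f => B z (step_rest y (A y) f))) => z.
  by have := measurable_step_rest y (A y) measurableT (mB z); rewrite setTI.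
move=> Iy; have [Ia Ib] := A_stay Iy.
rewrite (one_step diffY Iy (A_ge0 Iy) Ia Ib mB).
have [_ ->//] := ih (y + A y) S'; have [_ ->//] := ih (y - A y) S'.
Qed.

End chain_law.

(** * Compact exhaustion of the interior *)

Section exhaustion.
Context {R : realType}.
Variable I : set R.

Definition core_set (n : nat) : set R :=
  `[- n%:R, n%:R]%classic `&`
  \bigcap_(v in ~` I) [set x | n.+1%:R^-1 <= `|v - x|].

Lemma core_set_compact n : compact (core_set n).
Proof.
apply: (subclosed_compact _ (@segment_compact _ (- n%:R) n%:R)); last by move=> x [].
apply: closedI; first exact: itv_closed.
apply: closed_bigI => v _.
rewrite (_ : mkset _ = (fun x => `|v - x|) @^-1` [set u | n.+1%:R^-1 <= u])//.
apply: preimage_closed; last exact: closed_ge.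
move=> x _; apply: cvg_norm; apply: cvgB; [exact: cvg_cst|exact: cvg_id].
Qed.

Lemma core_set_interior n : core_set n `<=` interior I.
Proof.
move=> x [_ xI]; apply/nbhs_ballP; exists n.+1%:R^-1; first by rewrite /= invr_gt0.
move=> v; rewrite /ball /= => xv; apply: contrapT => nIv.
by have := xI v nIv; rewrite /= distrC leNgt xv.
Qed.

Lemma core_set_exhaust C : compact C -> C `<=` interior I ->
  \forall n \near \oo, C `<=` core_set n.
Proof.
move=> /compact_near_coveringP cC CI.
apply: (cC nat \oo (fun n x => core_set n x)) => x /CI.
move=> /nbhs_ballP[e /= e0 xI].
have e20 : 0 < e / 2 by rewrite divr_gt0.
exists (ball x (e / 2), [set n : nat | n.+1%:R^-1 < e / 2 /\ `|x| + e <= n%:R]).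
  split; first exact: nbhsx_ballx.
  near=> n; split; first by near: n; exact: (cvgr_lt _ cvg_invn).
  by near: n; exact: nbhs_infty_ger.
move=> [x' n] /= [xx' [ne xn]]; rewrite /ball /= in xx'.
split.
  rewrite /= in_itv /= -ler_norml.
  have := ler_normB x (x - x'); rewrite subKr; lra.
move=> v nIv /=; rewrite leNgt; apply/negP => vx'; apply: nIv; apply: xI.
rewrite /ball /= (le_lt_trans (ler_distD x' _ _))// (distrC x').
have := lt_trans vx' ne; lra.
Unshelve. all: by end_near. Qed.

End exhaustion.

(** * Equality of expectations *)

Section stopped_interpolation.
Context {R : realType}.

Lemma interpolation_stopped_cvg (h : R) (x : nat -> R) : 0 < h ->
  (fun n => interpolation h (fun k => x (minn k n))) @ \oo --> interpolation h x.
Proof.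
move=> h0; apply: cpath_cvg => T e e0.
near=> n => s /andP[s0 sT].
have sh0 : 0 <= s / h by rewrite divr_ge0// ltW.
suff -> : ev (interpolation h (fun k => x (minn k n))) s = ev (interpolation h x) s.
  by rewrite subrr normr0 ltW.
rewrite -[LHS]/(interpolate _ (\val (to_time s) / h)).
rewrite -[RHS]/(interpolate _ (\val (to_time s) / h)) to_timeK// /interpolate.
have /andP[k1 _] := truncn_itv sh0.
have kn : (Num.truncn (s / h) < n)%N.
  rewrite -(ltr_nat R) (le_lt_trans k1)//.
  apply: (@le_lt_trans _ _ (T / h)); first by rewrite ler_pM2r// invr_gt0.
  by near: n; exact: nbhs_infty_gtr.
by rewrite (minn_idPl (ltnW kn)) (minn_idPl kn).
Unshelve. all: by end_near. Qed.

End stopped_interpolation.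

Section expectation_embedding.
Context {R : realType} {I : set R} {l r : \bar R}.
Context {d : measure_display} {Omega : measurableType d}.
Context {Ft : time R -> set_system Omega} {Py : R -> probability Omega R}.
Context {Y : Omega -> cpath R} {m : {measure set (measurableTypeR R) -> \bar R}}.
Hypothesis diffY : general_diffusion I l r Py Ft Y m.
Local Notation Q := (path_law diffY).
Context {d' : measure_display} {T : measurableType d'} (P : probability T R).
Variable xi : nat -> {RV P >-> R}.
Hypothesis iid_xi : iid_signs xi.

Lemma signs_off_null : exists2 N : set T, measurable N /\ P N = 0%E &
  forall w, ~ N w -> forall k, xi k w = sign (heads xi k w).
Proof.
pose N := \bigcup_k ~` [set w | xi k w = 1 \/ xi k w = -1].
have mx k (c : R) : measurable [set w | xi k w = c].
  by rewrite -[mkset _]/(xi k @^-1` [set c]); exact: measurable_funPTI.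
have mk k : measurable [set w | xi k w = 1 \/ xi k w = -1].
  rewrite (_ : mkset _ = [set w | xi k w = 1] `|` [set w | xi k w = -1]).
    exact: measurableU.
  by apply/seteqP; split.
exists N.
  have mN : measurable N by apply: bigcupT_measurable => k; exact: measurableC.
  split => //; apply/(negligibleP _ mN).
  apply: negligible_bigcup => k; apply/negligibleP; first exact: measurableC.
  rewrite [LHS]probability_setC//.
  have [h1 h2] := signs_law iid_xi k.
  suff -> : P [set w | xi k w = 1 \/ xi k w = -1] = 1%E by rewrite subee.
  rewrite (_ : mkset _ = [set w | xi k w = 1] `|` [set w | xi k w = -1]); last first.
    by apply/seteqP; split.
  rewrite measureU//.
    transitivity ((2^-1 : R)%:E + (2^-1 : R)%:E)%E; last by rewrite -EFinD; congr EFin; lra.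
    by congr (_ + _)%E; [exact: h1|exact: h2].
  apply/seteqP; split => // w [/= -> /eqP].
  by rewrite -subr_eq0 opprK -(natrD _ 1 1) pnatr_eq0.
move=> w nN k; rewrite /sign /heads.
have [->|/eqP x1] := eqVneq (xi k w) 1; first by [].
apply: contrapT => x2; apply: nN; exists k => // -[] //.
Qed.

(** Stopped after n steps, the chain driven by xi and the embedded chain have the
same law, by [sign_chain_law] and [chain_law]; let n tend to infinity. *)
Lemma expectation_embedding (A : R -> R) (b : \bar R -> R) (h y M : R)
    (F : cpath R -> R) :
  0 < h -> I y -> (forall z, A z = b z%:E) ->
  (forall z, I z -> 0 <= A z) -> (forall z, I z -> I (z - A z) /\ I (z + A z)) ->
  continuous F -> (forall f, `|F f| <= M) ->
  (\int[P]_w (F (interpolation h (embedded_chain b y (xi^~ w))))%:E =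
   \int[Q y]_f (F (interpolation h (fun k => chain_at A k y f)))%:E)%E.
Proof.
move=> h0 Iy Ab A0 As cF FM.
have [N [mN PN] xiN] := signs_off_null.
pose ZT w := F (interpolation h (fun k => sign_chain A k y (fun i => heads xi i w))).
pose ZT_ n w := F (interpolation h (fun k => sign_chain A (minn k n) y (fun i => heads xi i w))).
pose ZW f := F (interpolation h (fun k => chain_at A k y f)).
pose ZW_ n f := F (interpolation h (fun k => chain_at A (minn k n) y f)).
have ZT_cvg w : ZT_ n w @[n --> \oo] --> ZT w.
  apply: (@cvg_comp _ _ _ _ F); last exact: cF.
  exact: (@interpolation_stopped_cvg _ h (fun k => sign_chain A k y _)).
have ZW_cvg f : ZW_ n f @[n --> \oo] --> ZW f.
  apply: (@cvg_comp _ _ _ _ F); last exact: cF.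
  exact: (@interpolation_stopped_cvg _ h (fun k => chain_at A k y f)).
have lawT n (B : set R) : measurable (ZT_ n @^-1` B) /\ P (ZT_ n @^-1` B) =
    (tree_average A n y [set x | B (F (interpolation h x))])%:E.
  have [mB] := sign_chain_law iid_xi A n y [set x | B (F (interpolation h x))] 0%N xpredT.
  rewrite expr0 mul1r => <-; split => //; congr (P _).
  rewrite (_ : heads_cylinder _ _ _ = setT) ?setTI//.
  by apply/seteqP; split.
have lawW n (B : set R) : measurable (ZW_ n @^-1` B : set (path_space R)) /\
    Q y (ZW_ n @^-1` B) =
    (tree_average A n y [set x | B (F (interpolation h x))])%:E.
  have [mB law] := chain_law diffY A0 As n y [set x | B (F (interpolation h x))].
  by split => //; rewrite -law.
have mT_ n : measurable_fun setT (ZT_ n) by move=> _ B _; rewrite setTI; have [] := lawT n B.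
have mW_ n : measurable_fun setT (ZW_ n : path_space R -> R).
  by move=> _ B _; rewrite setTI; have [] := lawW n B.
have mT : measurable_fun setT ZT.
  by apply: (@measurable_fun_cvg _ _ _ _ ZT_) => // w _; exact: ZT_cvg.
have mW : measurable_fun setT (ZW : path_space R -> R).
  by apply: (@measurable_fun_cvg _ _ _ _ ZW_) => // w _; exact: ZW_cvg.
transitivity (\int[P]_w (ZT w)%:E)%E.
  apply: (integral_eq_off_null mN PN) => w nN; congr (F (interpolation h _))%:E.
  apply/funext => k; rewrite -(embedded_chain_sign _ _ _ Ab).
  by congr embedded_chain; apply/funext => i; rewrite xiN.
have cT := bounded_cvg_integral (P := P) mT_ mT (fun n w => FM _)
  (nearW _ ZT_cvg).
have cW := bounded_cvg_integral (P := Q y) mW_ mW (fun n w => FM _)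
  (nearW _ ZW_cvg).
have TW n : (\int[P]_w (ZT_ n w)%:E = \int[Q y]_f (ZW_ n f)%:E)%E.
  apply: (@eq_law_integral _ _ _ _ _ _ _ _ _ M) => //.
  - by move=> w; exact: FM.
  - by move=> f; exact: FM.
  - by move=> B mB; rewrite (lawT n B).2 (lawW n B).2.
have TWE : (fun n => \int[P]_w (ZT_ n w)%:E)%E = (fun n => \int[Q y]_f (ZW_ n f)%:E)%E.
  by apply/funext => n; exact: TW.
rewrite TWE in cT.
transitivity (limn (fun n => \int[Q y]_f (ZW_ n f)%:E)%E).
  by apply/esym/cvg_lim => //; exact: cT.
by apply/cvg_lim => //; exact: cW.
Qed.

End expectation_embedding.

(** * Behaviour at the boundary *)

Section boundary.
Context {R : realType} {I : set R} {l r : \bar R}.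
Context {d : measure_display} {Omega : measurableType d}.
Context {Ft : time R -> set_system Omega} {Py : R -> probability Omega R}.
Context {Y : Omega -> cpath R} {m : {measure set (measurableTypeR R) -> \bar R}}.
Hypothesis diffY : general_diffusion I l r Py Ft Y m.
Local Notation Q := (path_law diffY).
Implicit Types (x y z s t h e eta : R).

(** A point of I strictly beyond l or r could be joined within I to p, which would
produce interior points beyond l or r. *)
Lemma boundary_point x p : interior I p -> I x -> ~ interior I x ->
  x%:E = l \/ x%:E = r.
Proof.
move=> Ip Ix nIx.
have itvI := gd_interval diffY.
have lrE := gd_interior diffY.
have lr_p : (l < p%:E < r)%E by move: Ip; rewrite lrE.
have inner u v w : I u -> I v -> u < w < v -> interior I w.
  move=> Iu Iv uwv.
  have : `]u, v[%classic `<=` I.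
    move=> z; rewrite /= in_itv => /andP[uz zv].
    by apply: (itvI u v) => //; rewrite !ltW.
  by rewrite open_subsetE//; apply; rewrite /= in_itv.
have Ip' := interior_subset Ip.
have between u v : (u%:E < v)%E -> u < p -> (p%:E < v \/ v <= p%:E)%E ->
    exists2 w, u < w < p & (w%:E < v)%E.
  move=> uv up _; case: v uv => [v| |] //.
    rewrite lte_fin => uv; exists ((u + Num.min v p) / 2).
      have := ge_min p v p; have : u < Num.min v p by rewrite lt_min uv up.
      by rewrite lexx orbT => h1 h2; apply/andP; split; lra.
    rewrite lte_fin; have := ge_min v v p; have : u < Num.min v p by rewrite lt_min uv up.
    by rewrite lexx => h1 h2; lra.
  by move=> _; exists ((u + p) / 2); [apply/andP; split; lra|rewrite ltry].
have : ~ (l < x%:E < r)%E by move=> h; apply: nIx; rewrite lrE.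
move=> /negP; rewrite negb_and -!leNgt => /orP[xl|rx].
  left; apply/eqP; rewrite eq_le xl /= leNgt; apply/negP => xl'.
  have xp : x < p by rewrite -lte_fin (lt_trans xl')//; case/andP: lr_p.
  have [|w /andP[xw wp] wl] := between x l xl' xp.
    by right; case/andP: lr_p => /ltW.
  have : interior I w by apply: (inner x p) => //; rewrite xw wp.
  by rewrite lrE /= => /andP[lw _]; have := lt_trans lw wl; rewrite ltxx.
right; apply/eqP; rewrite eq_le rx andbT leNgt; apply/negP => rx'.
have px : p < x by rewrite -lte_fin (lt_trans _ rx')//; case/andP: lr_p.
have [w pwx rw] : exists2 w, p < w < x & (r < w%:E)%E.
  have pr : (p%:E < r)%E by case/andP: lr_p.
  case: r rx' pr {lrE lr_p rx between} => [r'| |] //.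
  rewrite !lte_fin => rx' pr.
  by exists ((r' + x) / 2); [apply/andP; split; lra|rewrite lte_fin; lra].
have : interior I w by exact: (inner p x).
by rewrite lrE /= => /andP[_ wr]; have := lt_trans rw wr; rewrite ltxx.
Qed.

#[local] Instance ae_path_law_filter y : Filter (almost_everywhere (Q y)).
Proof. exact: ae_filter_ringOfSetsType. Qed.

Lemma boundary_absorbing y : interior I y ->
  {ae Q y, forall f, forall s t, 0 <= s <= t -> I (ev f s) ->
     ~ interior I (ev f s) -> ev f t = ev f s}.
Proof.
move=> Iy; have Iy' := interior_subset Iy.
have ab (b : \bar R) : b = l \/ b = r ->
    {ae Q y, forall f, forall s t, 0 <= s <= t -> I (ev f s) ->
     (ev f s)%:E = b -> ev f t = ev f s}.
  move=> blr; have [[z Iz zb]|nz] := pselect (exists2 z, I z & z%:E = b).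
    have zlr : z%:E = l \/ z%:E = r by rewrite zb.
    apply: filterS (absorbed_ae diffY Iy' Iz zlr) => f fz s t st _ fs.
    have fsz : ev f s = z by apply: EFin_inj; rewrite fs.
    by rewrite (fz s t st fsz) fsz.
  by apply: nearW => f s t _ If fb; exfalso; apply: nz; exists (ev f s).
apply: filterS2 (ab l (or_introl erefl)) (ab r (or_intror erefl)).
move=> f fl fr s t st If nIf.
by have [h|h] := boundary_point Iy If nIf; [exact: fl|exact: fr].
Qed.

Lemma ae_path y (H : path_space R -> Prop) : {ae Q y, forall f, H f} ->
  {ae Py y, forall w, H (Y w)}.
Proof.
move=> [N [mN N0 HN]]; exists (Y @^-1` N); split.
- by rewrite -[X in measurable X]setTI; exact: (diffusion_measurable diffY measurableT mN).
- by [].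
- by move=> w; apply: HN.
Qed.

End boundary.

(** * Smallness of the clock error *)

Section clock_convergence.
Context {R : realType} {I : set R} {l r : \bar R}.
Context {d : measure_display} {Omega : measurableType d}.
Context {Ft : time R -> set_system Omega} {Py : R -> probability Omega R}.
Context {Y : Omega -> cpath R} {m : {measure set (measurableTypeR R) -> \bar R}}.
Hypothesis diffY : general_diffusion I l r Py Ft Y m.
Local Notation Q := (path_law diffY).
Variables (hbar : R) (a : R -> \bar R -> R).
Hypothesis hbar_gt0 : 0 < hbar.
Hypothesis scale_a : scale_factors I l r hbar a.
Implicit Types (x y z s t h e eta : R).

Definition scale h z : R := a h z%:E.

Lemma scale_ge0_stay p h z : interior I p -> 0 < h < hbar -> I z ->
  0 <= scale h z /\ (I (z - scale h z) /\ I (z + scale h z)).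
Proof.
move=> Ip hh Iz; have [Iz'|nIz] := pselect (interior I z).
  have [I1 I2] := sf_state_space scale_a hh Iz'; split; last by split.
  apply: (sf_ge0 scale_a hh); move: Iz'; rewrite (gd_interior diffY) /=.
  by case/andP=> /ltW -> /ltW ->.
have [al ar] := sf_boundary scale_a hh.
have -> : scale h z = 0.
  by rewrite /scale; case: (boundary_point diffY Ip Iz nIz) => ->.
by rewrite subr0 addr0.
Qed.

(** For n h <= t the bound of [clock_error_probability] is at most
t (2 eta e + 7169 h) / eta^2. Choose first e, then h. *)
Lemma clock_error_small (K : set R) y eta t p :
  K `<=` interior I -> K y -> small_o_id (scale_error m a K) ->
  0 < eta -> 0 <= t -> 0 < p ->
  \forall h \near 0^'+, forall n : nat, n%:R * h <= t ->
    (Q y [set f | (eta < `|clock_error (scale h) K eta h n y 0 f|)%R] <= p%:E)%E.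
Proof.
move=> KI Ky oK eta0 t0 p0.
have t10 : 0 < t + 1 by lra.
pose e := Num.min (2^-1) (p * eta / (4 * (t + 1))).
have e0 : 0 < e.
  by rewrite lt_min invr_gt0 ltr0n /= divr_gt0// mulr_gt0.
have e1 : 0 <= e < 1.
  rewrite ltW//= (@le_lt_trans _ _ 2^-1)//; first by rewrite ge_min lexx.
  by rewrite invf_lt1// ltr1n.
have Iy := KI _ Ky.
have dl0 : 0 < p * eta ^+ 2 / (2 * 7169%:R * (t + 1)).
  by rewrite divr_gt0 ?mulr_gt0 ?exprn_gt0 ?ltr0n.
have := oK e e0; move=> oKe.
near=> h.
have h0 : 0 < h by near: h; exact: nbhs_right_gt.
have hh : 0 < h < hbar by rewrite h0; near: h; exact: nbhs_right_lt.
have hdl : h <= p * eta ^+ 2 / (2 * 7169%:R * (t + 1)).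
  by near: h; exact: nbhs_right_ltW.
have Kh : forall z, K z ->
    (`|(2^-1)%:E * tent_integral m z (scale h z) - h%:E| <= (e * h)%:E)%E.
  move=> z Kz.
  have oKh : (`|scale_error m a K h| <= (e * h)%:E)%E by near: h; exact: oKe.
  apply: le_trans oKh; apply: le_trans (lee_abs _).
  by apply: ereal_sup_ubound; exists z.
move=> n nt.
have A0 z : I z -> 0 <= scale h z by move=> Iz; have [] := scale_ge0_stay Iy hh Iz.
have As z : I z -> I (z - scale h z) /\ I (z + scale h z).
  by move=> Iz; have [] := scale_ge0_stay Iy hh Iz.
have KI' : K `<=` I by move=> z /KI; exact: interior_subset.
have Iy' := interior_subset Iy.
apply: (le_trans (clock_error_probability diffY A0 As n h0 e1 eta0 KI' Kh Iy')).
rewrite lee_fin.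
have eta20 : 0 < eta ^+ 2 by rewrite exprn_gt0.
rewrite ler_pdivrMr//.
have b1 : 2 * eta * e * t <= p * eta ^+ 2 / 2.
  have ee : e <= p * eta / (4 * (t + 1)) by rewrite ge_min lexx orbT.
  have : e * (4 * (t + 1)) <= p * eta by rewrite -ler_pdivlMr// mulr_gt0.
  move=> ee'; have e0' := ltW e0; nra.
have b2 : 7169%:R * h * t <= p * eta ^+ 2 / 2.
  have : h * (2 * 7169%:R * (t + 1)) <= p * eta ^+ 2.
    by rewrite -ler_pdivlMr// !mulr_gt0// ltr0n.
  have : 0 <= 7169%:R * h by rewrite mulr_ge0 ?ler0n// ltW.
  nra.
have c0 : 0 <= 2 * eta * e + 7169%:R * h.
  by rewrite addr_ge0 ?mulr_ge0 ?ler0n// ltW.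
have : (n%:R * h) * (2 * eta * e + 7169%:R * h) <= t * (2 * eta * e + 7169%:R * h).
  by rewrite ler_wpM2r.
nra.
Unshelve. all: by end_near. Qed.

End clock_convergence.

(** * The functional limit theorem *)

Lemma measurable_embedded_path {R : realType} (A : R -> R) (h y s : R) :
  measurable_fun setT (fun f : path_space R =>
    ev (interpolation h (fun k => chain_at A k y f)) s).
Proof.
rewrite (_ : (fun _ => _) = fun f : path_space R =>
  interpolate (fun k => chain_at A k y f) (\val (to_time s) / h))//.
rewrite /interpolate; apply: measurable_funD; first exact: measurable_chain_at.
by apply: measurable_funM => //; apply: measurable_funB; exact: measurable_chain_at.
Qed.

Theorem theorem1p1 (R : realType) (I : set R) (l r : \bar R)
    (d : measure_display) (Omega : measurableType d)
    (Ft : time R -> set_system Omega)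
    (Py : R -> probability Omega R) (Y : Omega -> cpath R)
    (m : {measure set (measurableTypeR R) -> \bar R})
    (diffusionY : general_diffusion I l r Py Ft Y m)
    (hbar : R) (hbar_gt0 : 0 < hbar) (a : R -> \bar R -> R)
    (scale_a : scale_factors I l r hbar a)
    (d' : measure_display) (T : measurableType d') (P : probability T R)
    (xi : nat -> {RV P >-> R}) (iid_xi : iid_signs xi)
    (condition_A : forall K : set R, K `<=` interior I -> compact K ->
       K !=set0 -> small_o_id (scale_error m a K))
    (y : R) (Iy : interior I y)
    (F : cpath R -> R) (F_continuous : continuous F)
    (F_bounded : exists M : R, forall f : cpath R, `|F f| <= M) :
  'E_P[fun w => F (associated_process a xi h y w)]%E @[h --> 0^'+]
    --> 'E_(Py y)[fun w => F (Y w)]%E.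
Proof.
have [M FM] := F_bounded.
have Iy' := interior_subset Iy.
have FYint : (Py y).-integrable setT (fun w => (F (Y w))%:E).
  apply: (@bounded_integrable _ _ _ (Py y) (F \o Y) M); last by move=> w; exact: FM.
  apply: (@measurable_continuous_functional _ _ _ F Y) => // s.
  exact: (measurableT_comp (@measurable_ev _ setT s Logic.I)
    (diffusion_measurable diffusionY)).
pose phi h := (\int[path_law diffusionY y]_f
  (F (interpolation h (fun k => chain_at (scale a h) k y f)))%:E)%E.
have mphi h : measurable_fun setT (fun f : path_space R =>
    F (interpolation h (fun k => chain_at (scale a h) k y f))).
  apply: (@measurable_continuous_functional _ _ _ F
    (fun f : path_space R => interpolation h (fun k => chain_at (scale a h) k y f))) => //.
  by move=> s; exact: measurable_embedded_path.
have phi_int h : (path_law diffusionY y).-integrable setT (fun f : path_space R =>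
    (F (interpolation h (fun k => chain_at (scale a h) k y f)))%:E).
  by apply: (@bounded_integrable _ _ _ _ _ M) => // f; exact: FM.
pose L := (\int[Py y]_w (F (Y w))%:E)%E.
have Lfin : L \is a fin_num by exact: integrable_fin_num.
have phiE h : 0 < h < hbar ->
    'E_P[fun w => F (associated_process a xi h y w)]%E = phi h.
  move=> hh; have /andP[h0 _] := hh; rewrite unlock.
  apply: (expectation_embedding diffusionY iid_xi (A := scale a h) (b := a h)
    h0 Iy' _ _ _ F_continuous FM) => //.
  - by move=> z Iz; have [] := scale_ge0_stay diffusionY scale_a Iy hh Iz.
  - by move=> z Iz; have [] := scale_ge0_stay diffusionY scale_a Iy hh Iz.
have LE : 'E_(Py y)[fun w => F (Y w)]%E = L by rewrite unlock.
rewrite LE.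
suff phi_cvg : phi h @[h --> 0^'+] --> L.
  apply: cvg_trans phi_cvg; apply: near_eq_cvg; near=> h; apply/esym/phiE.
  by apply/andP; split; near: h; [exact: nbhs_right_gt|exact: nbhs_right_lt].
(* Adding y makes K n nonempty. *)
pose K n := core_set I n `|` [set y].
have KI n : K n `<=` interior I.
  by move=> z [/core_set_interior//|->].
have Kc n : compact (K n).
  by apply: compactU; [exact: core_set_compact|exact: compact_set1].
(* Enough steps of size h to cover the time interval [0, n + 1]. *)
pose N (n : nat) (h : R) := (Num.truncn (n.+1%:R / h)).+1.
pose F_ n h : set (path_space R) := [set f | n.+1%:R^-1 <
  `|clock_error (scale a h) (K n) n.+1%:R^-1 h (N n h) y 0 f|].
have good n : \forall h \near 0^'+, [/\ 0 < h < hbar, h < n.+1%:R^-1 &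
    (path_law diffusionY y (F_ n h) <= (1 / (2 ^ (n + 1))%:R)%:E)%E].
  have oK := condition_A (K n) (@KI n) (Kc n) (ex_intro _ y (or_intror erefl)).
  have eta0 : 0 < n.+1%:R^-1 :> R by rewrite invr_gt0.
  have t0 : 0 <= n.+2%:R :> R by [].
  have p0 : 0 < 1 / (2 ^ (n + 1))%:R :> R by rewrite divr_gt0 ?ltr0n ?expn_gt0.
  have err := clock_error_small diffusionY hbar_gt0 scale_a (@KI n)
    (or_intror erefl) oK eta0 t0 p0.
  near=> h.
  have h0 : 0 < h by near: h; exact: nbhs_right_gt.
  have h1 : h < n.+1%:R^-1 by near: h; exact: nbhs_right_lt.
  have herr : forall k : nat, k%:R * h <= n.+2%:R ->
    (path_law diffusionY y [set f | (n.+1%:R^-1 < `|clock_error (scale a h) (K n)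
       n.+1%:R^-1 h k y 0 f|)%R] <= (1 / (2 ^ (n + 1))%:R)%:E)%E.
    by near: h; exact: err.
  split => //.
    by rewrite h0 /=; near: h; exact: nbhs_right_lt.
  apply: herr; rewrite /N -natr1 mulrDl mul1r -[n.+2%:R]natr1 lerD//.
    rewrite -ler_pdivlMr//.
    by have /andP[] := truncn_itv (ltW (divr_gt0 (ltr0Sn R n) h0)).
  by rewrite (le_trans (ltW h1))// invf_le1// ler1n.
(* If the limit fails, there are arbitrarily small bad step sizes; pick one in each
   of the neighbourhoods in [good]. *)
apply: contrapT => ncvg.
have [e e0 bad] : exists2 e, 0 < e & ~ \forall h \near 0^'+, `|fine L - fine (phi h)| <= e.
  apply: contrapT => nbad; apply: ncvg.
  rewrite -(fineK Lfin); apply/fine_cvgP; split.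
    by apply: nearW => h; exact: (integrable_fin_num _ (phi_int h)).
  apply/cvgrPdist_le => e e0; apply: contrapT => h; apply: nbad; by exists e.
have pick n : exists h, [/\ 0 < h < hbar, h < n.+1%:R^-1,
    (path_law diffusionY y (F_ n h) <= (1 / (2 ^ (n + 1))%:R)%:E)%E &
    ~ (`|fine L - fine (phi h)| <= e)].
  apply: contrapT => nh; apply: bad; apply: filterS (good n) => h [h1 h2 h3].
  by apply: contrapT => h4; apply: nh; exists h.
have [h_ h_P] := choice pick.
have h_hbar n : 0 < h_ n < hbar by have [] := h_P n.
have h_gt0 n : 0 < h_ n by case/andP: (h_hbar n).
have mF n : measurable (F_ n (h_ n)).
  have mc : measurable_fun setT (fun f : path_space R =>
      clock_error (scale a (h_ n)) (K n) n.+1%:R^-1 (h_ n) (N n (h_ n)) y 0 f).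
    exact: (measurable_fun_pair2 (f := fun sf : R * path_space R =>
      clock_error (scale a (h_ n)) (K n) n.+1%:R^-1 (h_ n) (N n (h_ n)) y sf.1 sf.2)
      0 (measurable_clock_error _ _ _ _ _ _)).
  rewrite (_ : F_ n (h_ n) = (fun f : path_space R => `|clock_error (scale a (h_ n))
    (K n) n.+1%:R^-1 (h_ n) (N n (h_ n)) y 0 f|) @^-1` [set` `]n.+1%:R^-1, +oo[%R]).
    rewrite -[X in measurable X]setTI.
    have mn : measurable_fun setT (fun f : path_space R => `|clock_error
        (scale a (h_ n)) (K n) n.+1%:R^-1 (h_ n) (N n (h_ n)) y 0 f|).
      exact: (measurableT_comp (@normr_measurable _ _) mc).
    exact: (mn measurableT _ (measurable_itv _)).
  by apply/seteqP; split => f /=; rewrite in_itv /= andbT.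
have aeF : {ae path_law diffusionY y, forall f, exists n0, forall n, (n0 <= n)%N ->
    ~ F_ n (h_ n) f}.
  have lim0 : path_law diffusionY y (lim_sup_set (fun n => F_ n (h_ n))) = 0%E.
    apply: lim_sup_set_cvg0 => //.
    apply: (@le_lt_trans _ _ (\sum_(n <oo) (1 / (2 ^ (n + 1))%:R)%:E)%E).
      by apply: lee_nneseries => // n _; have [] := h_P n.
    rewrite (_ : limn _ = (1 / 2 ^+ 0)%:E) ?ltry//.
    by apply/cvg_lim => //; exact: (@cvg_geometric_eseries_half R 1 0).
  exists (lim_sup_set (fun n => F_ n (h_ n))); split => //.
    apply: bigcapT_measurable => n; exact: bigcup_measurable.
  move=> f /= nf n _ /=; apply: contrapT => nFf; apply: nf.
  by exists n => k nk Fk; apply: nFf; exists k.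
have aeC : {ae path_law diffusionY y, forall f, forall n k,
    chain_at (scale a (h_ n)) k y f = ev f (chain_time (scale a (h_ n)) k y f)}.
  apply: ae_foralln => n; apply: (chain_on_path diffusionY _ _ Iy').
  - by move=> z Iz; have [] := scale_ge0_stay diffusionY scale_a Iy (h_hbar n) Iz.
  - by move=> z Iz; have [] := scale_ge0_stay diffusionY scale_a Iy (h_hbar n) Iz.
have aeS : {ae path_law diffusionY y, forall f, ev f 0 = y}.
  by apply: (probability1_ae (measurable_ev_eq 0 y)) => //; exact: path_law_start.
have h_cvg : h_ @ \oo --> 0.
  apply/cvgrPdist_lt => e1 e10.
  have : \forall n \near \oo, n.+1%:R^-1 < e1 by exact: (cvgr_lt _ cvg_invn).
  apply: filterS => n ne.
  rewrite sub0r normrN gtr0_norm//; have [_ hn _ _] := h_P n.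
  exact: lt_trans hn ne.
pose Z_ n w := F (interpolation (h_ n)
  (fun k => chain_at (scale a (h_ n)) k y (Y w : path_space R))).
have ZL : {ae Py y, forall w, Z_ n w @[n --> \oo] --> F (Y w)}.
  have aeFS : {ae Py y, forall w, ev (Y w) 0 = y /\
      exists n0, forall n, (n0 <= n)%N -> ~ F_ n (h_ n) (Y w)}.
    by apply: filterS2 (ae_path aeS) (ae_path aeF) => w.
  apply: filterS3 aeFS (ae_path aeC) (ae_path (boundary_absorbing diffusionY Iy)).
  move=> w [wS [n0 wF]] wC wB.
  apply: (@cvg_comp _ _ _ _ F); last exact: F_continuous.
  apply: (@embedded_interpolation_cvg _ (Y w) (interior I) h_
    (fun n k => chain_at (scale a (h_ n)) k y (Y w))
    (fun n k => chain_time (scale a (h_ n)) k y (Y w))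
    (fun n => N n (h_ n)) K) => //.
  - exact: open_interior.
  - by rewrite wS.
  - move=> s t st; apply: wB => //.
    exact: (csm_state_space (gd_process diffusionY)).
  - by move=> n k; exact: chain_time_ge0.
  - by move=> n j k; exact: chain_time_le.
  - by move=> n; rewrite -ler_pdivrMr// ltW// /N truncnS_gt.
  - move=> C cC CI; apply: filterS (core_set_exhaust cC CI) => n Cn z /Cn.
    by left.
  - exists n0 => // n n0n k kN Kk.
    have /negP := wF n n0n; rewrite -leNgt => err.
    by have := clock_errorP err kN Kk; rewrite add0r.
have mZ n : measurable_fun setT (Z_ n).
  exact: (measurableT_comp (mphi (h_ n)) (diffusion_measurable diffusionY)).
have mFY : measurable_fun setT (fun w => F (Y w)).
  by have /measurable_int/measurable_EFinP := FYint.
have := bounded_cvg_integral (P := Py y) mZ mFY (fun n w => FM _) ZL.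
rewrite (_ : (fun n => _) = fun n => phi (h_ n)); last first.
  apply/funext => n; rewrite /phi.
  rewrite (integral_pushforward (diffusion_measurable diffusionY))//.
  - apply/measurable_EFinP; exact: mphi.
  - rewrite preimage_setT; apply: (@bounded_integrable _ _ _ (Py y) (Z_ n) M) => // w.
    exact: FM.
rewrite -/L -(fineK Lfin) => /fine_cvgP[_ /cvgrPdist_le/(_ _ e0)[n1 _ n1P]].
by have [_ _ _] := h_P n1; apply; exact: (n1P n1 (leqnn n1)).
Unshelve. all: by end_near. Qed.
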